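(* Let $0<p\leq q\leq p+1$. Suppose $K_1(z,w)=\sum_{k=0}^\infty a_k^p(z\bar w)^k$ and $K_2(z,w)=\sum_{k=0}^\infty a_k^q(z\bar w)^k$ are any two reproducing kernels on the open unit disc $\mathbb D$ such that $\{a_k\}_{k\geq 0}$ is a completely alternating sequence. Then the multiplication operator $M_z$ on $\mathcal H(K_1+K_2)$ is subnormal.
   Context: $\mathbb D=\{z\in\mathbb C:|z|<1\}$. A sequence $\{a_k\}_{k\geq 0}$ of positive real numbers is completely alternating if $\sum_{j=0}^n(-1)^j\binom{n}{j}a_{m+j}\leq 0$ for all $m\geq 0$, $n\geq 1$. For a positive definite kernel $K$ on $\mathbb D$ (holomorphic in the first variable and anti-holomorphic in the second), $\mathcal H(K)$ denotes the reproducing kernel Hilbert space of holomorphic functions on $\mathbb D$ with reproducing kernel $K$, and $M_z$ denotes the operator of multiplication by the coordinate function, $(M_zf)(z)=zf(z)$. A bounded operator $T$ on a Hilbert space $\mathcal H$ is subnormal if there are a Hilbert space $\mathcal K\supset\mathcal H$ and a bounded normal operator $N$ on $\mathcal K$ with $N(\mathcal H)\subset\mathcal H$ and $N|_{\mathcal H}=T$. *)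

(* Defs.v *)
From HB Require Import structures.
From mathcomp Require Import all_boot all_order all_algebra.
From mathcomp Require Import sesquilinear complex.
From mathcomp Require Import all_classical all_reals all_analysis.

Set Implicit Arguments.
Unset Strict Implicit.
Unset Printing Implicit Defensive.

Import Order.TTheory GRing.Theory Num.Theory.
Import numFieldNormedType.Exports.

Local Open Scope classical_set_scope.
Local Open Scope ring_scope.

(* The type [R[i]] itself carries no topology in the libraries; as the sort of
   a [numClosedFieldType] it inherits the norm topology given by [`|z|].
   Reminder: on this type [x <= y] means that [y - x] is a nonnegative real. *)
Definition cplx (R : realType) : numClosedFieldType := R[i]%C.

Definition disc (R : realType) : set (cplx R) := [set z | `|z| < 1].
Arguments disc : clear implicits.

Definition completely_alternating (R : realType) (a : nat -> R) : Prop :=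
  (forall k, 0 < a k) /\
  forall m n : nat, (1 <= n)%N ->
    \sum_(0 <= j < n.+1) (-1) ^+ j * 'C(n, j)%:R * a (m + j)%N <= 0.

(* [derivable f z 1] is the existence of the limit of the difference quotient
   [h^-1 * (f (z + h) - f z)] as the complex number [h <> 0] tends to [0]. *)
Definition holomorphic_on_disc (R : realType) (f : cplx R -> cplx R) : Prop :=
  forall z, z \in disc R -> derivable f z 1.

(* Functions on the disc are represented by functions on the whole complex
   plane; their values outside the disc are irrelevant everywhere below. *)
Definition pd_kernel (R : realType) (K : cplx R -> cplx R -> cplx R) : Prop :=
  [/\ forall (n : nat) (z c : 'I_n -> cplx R),
        (forall i, z i \in disc R) ->
        0 <= \sum_(i < n) \sum_(j < n) c i * (c j)^* * K (z i) (z j),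
      forall w, w \in disc R -> holomorphic_on_disc (fun z => K z w) &
      forall z, z \in disc R -> holomorphic_on_disc (fun w => (K z w)^*)].

Definition has_expansion (R : realType) (b : nat -> R)
    (K : cplx R -> cplx R -> cplx R) : Prop :=
  forall z w : cplx R, z \in disc R -> w \in disc R ->
    series (fun k => (real_complex R (b k) : cplx R) * (z * w^*) ^+ k) @ \oo
      --> K z w.

(* [hdot] is linear in its first and conjugate-linear in its second argument. *)
Record hilbert (R : realType) := Hilbert {
  hsort :> completeNormedModType (cplx R) ;
  hdot : {dot hsort for (@Num.conj (cplx R))} ;
  hdot_norm : forall f : hsort, `|f| ^+ 2 = hdot f f }.

Definition bounded_operator (R : realType) (H : hilbert R)
    (T : {linear H -> H}) : Prop :=
  exists M : cplx R, forall f : H, `|T f| <= M * `|f|.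

Definition adjoint_operators (R : realType) (H : hilbert R)
    (T S : {linear H -> H}) : Prop :=
  forall f g : H, hdot H (T f) g = hdot H f (S g).

Definition normal_operator (R : realType) (H : hilbert R)
    (N : {linear H -> H}) : Prop :=
  bounded_operator N /\
  exists2 S : {linear H -> H}, adjoint_operators N S &
    forall f, N (S f) = S (N f).

(* The inclusion of H into the larger space K is an isometric embedding [V];
   the last clause says both that N leaves the image of H invariant and that
   its restriction there is T. *)
Definition subnormal (R : realType) (H : hilbert R)
    (T : {linear H -> H}) : Prop :=
  bounded_operator T /\
  exists (K : hilbert R) (V : {linear H -> K}) (N : {linear K -> K}),
    [/\ forall f g : H, hdot K (V f) (V g) = hdot H f g,
        normal_operator N &
        forall f : H, N (V f) = V (T f)].

(* H, with [ev f z] the value at z of the element f, is the Hilbert space of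
   holomorphic functions on the disc with reproducing kernel K.  Injectivity of
   [ev] makes elements of H the same thing as functions on the disc; these
   clauses determine H up to a unitary that preserves values. *)
Definition is_rkhs (R : realType) (K : cplx R -> cplx R -> cplx R)
    (H : hilbert R) (ev : H -> cplx R -> cplx R) : Prop :=
  [/\ forall (c : cplx R) (f g : H) z, z \in disc R ->
        ev (c *: f + g) z = c * ev f z + ev g z,
      forall f g : H, (forall z, z \in disc R -> ev f z = ev g z) -> f = g,
      forall f : H, holomorphic_on_disc (ev f) &
      forall w, w \in disc R -> exists k_w : H,
        (forall z, z \in disc R -> ev k_w z = K z w) /\
        (forall f : H, hdot H f k_w = ev f w)].

Definition is_mult_by_z (R : realType) (H : hilbert R)
    (ev : H -> cplx R -> cplx R) (T : {linear H -> H}) : Prop :=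
  forall (f : H) z, z \in disc R -> ev (T f) z = z * ev f z.

(* Main.v *)
Require Import Defs.
From HB Require Import structures.
From mathcomp Require Import freeg.
From mathcomp Require Import all_boot all_order all_algebra.
From mathcomp Require Import sesquilinear complex.
From mathcomp Require Import all_classical all_reals all_analysis.
From mathcomp Require Import ring lra zify.

(** Write b_k = a_k^p + a_k^q for the coefficients of the kernel K1 + K2.  In the
    space with this kernel the monomials z^k are orthogonal, with squared norm
    c_k = 1 / b_k, and their span is dense; so M_z is a weighted shift, and everything
    depends on the single sequence c.

    The sequence c is completely monotone ([cm_inv_sum_powR]).  Indeed
    c = a^(-p) (1 + a^(q-p))^(-1).  A sequence is completely alternating when its
    increments are completely monotone, and such sequences behave like Bernstein
    functions: a^r is again completely alternating for 0 <= r <= 1, negative powers of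
    positive completely alternating sequences are completely monotone, and completely
    monotone sequences are stable under products.  Both facts on powers come from a mean
    value argument along the segment from a_k to a_(k+1) ([cm_upto_mean_value]).

    By Hausdorff's theorem c_m is the m-th moment of a measure mu on [0,1].  If nu is
    the rotation invariant measure on the closed disc for which |z|^2 has law mu, then
    c_k = int |z|^(2k) dnu, so the space embeds isometrically in L^2(nu), where
    multiplication by z is normal.  The proof works with the Gram matrix of the functions
    z^k conj(z)^i in L^2(nu) in place of nu: it is
    the kernel with value c_(k+j) at ((k,i),(l,j)) if k + j = l + i and 0 otherwise.
    It is positive definite because c is a limit of moment sequences of finitely
    supported measures, given by Bernstein polynomials ([cvg_bernstein_moment],
    [psd_moment_kernel]).

    Every positive definite kernel is the Gram matrix of a total family g of some
    Hilbert space ([kernel_realization], through the completion of a semi-inner product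
    space), and a map between total families that decreases Gram matrices extends to
    a linear map of norm at most 1 ([nonexpansive_extension]).  This yields at once M_z
    itself, the isometry z^k |-> g(k,0), the operator g(k,i) |-> g(k+1,i) and
    its adjoint g(k,i) |-> g(k,i+1); the last two commute because they shift different
    indices ([weighted_shift_subnormal]).

    The monomials are elements of the reproducing kernel space because z^k is the limit,
    as w tends to 0, of the kernel function at w deprived of its first k terms and
    suitably rescaled ([monomial_step]). *)

Set Implicit Arguments.
Unset Strict Implicit.
Unset Printing Implicit Defensive.

Import Order.TTheory GRing.Theory Num.Theory.
Import numFieldNormedType.Exports.

Local Open Scope classical_set_scope.
Local Open Scope ring_scope.

(** * Completely monotone sequences *)

Section CompletelyMonotone.
Variable R : realType.
Implicit Types (a c d : nat -> R) (n m k : nat).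

Definition backdiff c : nat -> R := fun m => c m - c m.+1.
Definition shift_seq c : nat -> R := fun m => c m.+1.

(** Complete monotonicity truncated at order n: the statements on powers below are
    proved by induction on n, the derivative being controlled to a lower order than
    the function. *)
Fixpoint cm_upto n c : Prop :=
  (forall m, 0 <= c m) /\ if n is n'.+1 then cm_upto n' (backdiff c) else True.

Definition completely_monotone c : Prop := forall n, cm_upto n c.

(** Named after Bernstein functions, whose derivatives are completely monotone. *)
Definition bernstein_seq a : Prop :=
  (forall m, 0 < a m) /\ completely_monotone (fun m => a m.+1 - a m).

Lemma cm_upto_ge0 n c : cm_upto n c -> forall m, 0 <= c m.
Proof. by case: n => [|n] []. Qed.

Lemma cm_uptoP n c :
  cm_upto n c <-> forall k, (k <= n)%N -> forall m, 0 <= iter k backdiff c m.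
Proof.
elim: n c => [|n IHn] c /=; split.
- by move=> [c_ge0 _] [|k].
- by move=> c_ge0; split => // m; exact: (c_ge0 0%N).
- move=> [c_ge0 /IHn dc] [|k] // k_n m; rewrite iterSr; exact: dc.
- move=> c_ge0; split => [m|]; first exact: (c_ge0 0%N).
  by apply/IHn => k k_n m; rewrite -iterSr; exact: c_ge0.
Qed.

Lemma eq_cm_upto n c d : c =1 d -> cm_upto n c -> cm_upto n d.
Proof. by move=> /funext ->. Qed.

Lemma cm_uptoW n c : cm_upto n.+1 c -> cm_upto n c.
Proof.
by move=> /cm_uptoP h; apply/cm_uptoP => k k_n; apply: h; exact: leqW.
Qed.

Lemma iter_backdiffE n c m :
  iter n.+1 backdiff c m = iter n backdiff c m - iter n backdiff c m.+1.
Proof. by []. Qed.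

Lemma iter_backdiff_shift n c m :
  iter n backdiff (shift_seq c) m = iter n backdiff c m.+1.
Proof.
by elim: n m => [//|n IHn] m; rewrite !iter_backdiffE !IHn.
Qed.

Lemma cm_upto_shift n c : cm_upto n c -> cm_upto n (shift_seq c).
Proof.
move=> /cm_uptoP h; apply/cm_uptoP => k k_n m.
by rewrite iter_backdiff_shift; exact: h.
Qed.

Lemma cm_uptoD n c d :
  cm_upto n c -> cm_upto n d -> cm_upto n (fun m => c m + d m).
Proof.
elim: n c d => [|n IHn] c d /= [c_ge0 cc] [d_ge0 dd].
  by split=> // m; rewrite addr_ge0.
split=> [m|]; first by rewrite addr_ge0.
apply: eq_cm_upto (IHn _ _ cc dd) => m; rewrite /backdiff; ring.
Qed.

(** Leibniz rule: the difference of c d is (difference of c) d + (shift of c)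
    (difference of d). *)
Lemma cm_uptoM n c d :
  cm_upto n c -> cm_upto n d -> cm_upto n (fun m => c m * d m).
Proof.
elim: n c d => [|n IHn] c d.
  by move=> [c_ge0 _] [d_ge0 _]; split=> // m; rewrite mulr_ge0.
move=> cc dd; split=> [m|].
  by rewrite mulr_ge0 //; [exact: (cm_upto_ge0 cc)|exact: (cm_upto_ge0 dd)].
have := cm_uptoD (IHn _ _ cc.2 (cm_uptoW dd))
  (IHn _ _ (cm_upto_shift (cm_uptoW cc)) dd.2).
by apply: eq_cm_upto => m; rewrite /backdiff /shift_seq; ring.
Qed.

Lemma cm_upto_cst n (x : R) : 0 <= x -> cm_upto n (fun=> x).
Proof.
elim: n x => [|n IHn] x x_ge0; split => //.
by apply: eq_cm_upto (IHn 0 (lexx 0)) => m; rewrite /backdiff subrr.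
Qed.

Lemma cm_backdiff c : completely_monotone c -> completely_monotone (backdiff c).
Proof. by move=> cc n; have [] := cc n.+1. Qed.

Lemma is_derive_iter_backdiff n (f f' : nat -> R -> R) m (t : R) :
  (forall k, is_derive t 1 (f k) (f' k t)) ->
  is_derive t 1 (fun x => iter n backdiff (f ^~ x) m)
    (iter n backdiff (f' ^~ t) m).
Proof.
move=> df; elim: n m => [|n IHn] m /=; first exact: df.
by rewrite /backdiff; apply: is_deriveB.
Qed.

(** Each iterated difference of f(.,1) - f(.,0) is, by the mean value theorem, the
    same difference of the derivative at an intermediate time. *)
Lemma cm_upto_mean_value n (f f' : nat -> R -> R) :
  (forall k (t : R), 0 <= t <= 1 -> is_derive t 1 (f k) (f' k t)) ->
  (forall t : R, 0 <= t <= 1 -> cm_upto n (f' ^~ t)) ->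
  cm_upto n (fun k => f k 1 - f k 0).
Proof.
move=> df cm_f'; apply/cm_uptoP => j j_n m.
have -> : iter j backdiff (fun k => f k 1 - f k 0) m =
    iter j backdiff (f ^~ 1) m - iter j backdiff (f ^~ 0) m.
  elim: j m {j_n} => [//|j IHj] m; rewrite !iter_backdiffE !IHj; ring.
have der (t : R) : 0 <= t <= 1 -> is_derive t 1
    (fun x => iter j backdiff (f ^~ x) m) (iter j backdiff (f' ^~ t) m).
  by move=> t01; apply: is_derive_iter_backdiff => k; exact: df.
have [||z z01 ->] := @MVT R (fun x => iter j backdiff (f ^~ x) m)
    (fun x => iter j backdiff (f' ^~ x) m) 0 1 ltr01.
- by move=> x; rewrite in_itv/= => /andP[x0 x1]; apply: der; rewrite !ltW.
- apply: derivable_within_continuous => x; rewrite in_itv/= => x01.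
  by have [] := der x x01.
rewrite subr0 mulr1; move: z01; rewrite in_itv/= => /andP[z0 z1].
have z01 : 0 <= z <= 1 by rewrite !ltW.
by move/cm_uptoP: (cm_f' z z01); exact.
Qed.

(** The interpolant is (1 - t) a + t (shift of a), which has completely monotone
    increments too. *)
Lemma bernstein_interp a t : bernstein_seq a -> 0 <= t <= 1 ->
  bernstein_seq (fun m => a m + t * (a m.+1 - a m)).
Proof.
move=> [a_gt0 da] /andP[t_ge0 t_le1]; split=> [m|n].
  have := a_gt0 m; have := a_gt0 m.+1; nra.
have t'_ge0 : 0 <= 1 - t by rewrite subr_ge0.
have := cm_uptoD (cm_uptoM (cm_upto_cst n t'_ge0) (da n))
  (cm_uptoM (cm_upto_cst n t_ge0) (cm_upto_shift (da n))).
by apply: eq_cm_upto => m; rewrite /shift_seq; ring.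
Qed.

Lemma is_derive_interp_powR (x y s t : R) : 0 < x -> 0 < y -> 0 <= t <= 1 ->
  is_derive t 1 (fun t => (x + t * (y - x)) `^ s)
    (s * (x + t * (y - x)) `^ (s - 1) * (y - x)).
Proof.
move=> x_gt0 y_gt0 /andP[t_ge0 t_le1].
have z_gt0 : 0 < x + t * (y - x) by nra.
have aff : is_derive t 1 (fun t => x + t * (y - x)) (y - x).
  apply: is_derive_eq; rewrite scaler0 add0r.
  by rewrite scaler1 add0r mul1r.
have pow := is_derive1_powR s z_gt0.
exact: (@is_derive1_comp R (fun z => z `^ s) (fun t => x + t * (y - x)) _ _ _ pow aff).
Qed.

(** The decrement of a^(-s) is the variation of the (-s)-th power along the segment
    from a_k to a_(k+1); its derivative is s (...)^(-s-1) (a_(k+1) - a_k), where the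
    power is handled by the induction hypothesis with exponent s + 1. *)
Lemma cm_upto_powRN n a s : bernstein_seq a -> 0 <= s ->
  cm_upto n (fun m => a m `^ (- s)).
Proof.
elim: n a s => [|n IHn] a s a_bern s_ge0.
  by split=> // m; exact: powR_ge0.
split=> [m|]; first exact: powR_ge0.
pose f k t := - ((a k + t * (a k.+1 - a k)) `^ (- s)).
have : cm_upto n (fun k => f k 1 - f k 0).
  apply: (@cm_upto_mean_value n f (fun k (t : R) =>
    s * (a k + t * (a k.+1 - a k)) `^ (- (s + 1)) * (a k.+1 - a k))).
    move=> k t t01; have [a_gt0 _] := a_bern.
    have := is_derive_interp_powR (- s) (a_gt0 k) (a_gt0 k.+1) t01.
    move=> /is_deriveN; rewrite /f => /is_derive_eq; apply.
    by rewrite opprD; ring.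
  move=> t t01; apply: cm_uptoM; last by case: a_bern.
  apply: cm_uptoM; first exact: cm_upto_cst.
  by apply: IHn; [exact: bernstein_interp|rewrite addr_ge0].
apply: eq_cm_upto => k; rewrite /f /backdiff mul0r addr0 mul1r opprK addrC.
by rewrite [a k + _]addrC subrK.
Qed.

(** Same argument as for negative powers: the derivative of the r-th power has the
    exponent r - 1 <= 0. This is where r <= 1 enters. *)
Lemma bernstein_powR a r : bernstein_seq a -> 0 <= r <= 1 ->
  bernstein_seq (fun m => a m `^ r).
Proof.
move=> a_bern /andP[r_ge0 r_le1]; have [a_gt0 da] := a_bern.
split=> [m|n]; first by rewrite powR_gt0.
pose f k t := (a k + t * (a k.+1 - a k)) `^ r.
have : cm_upto n (fun k => f k 1 - f k 0).
  apply: (@cm_upto_mean_value n f (fun k (t : R) =>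
    r * (a k + t * (a k.+1 - a k)) `^ (r - 1) * (a k.+1 - a k))).
    by move=> k t t01; exact: is_derive_interp_powR.
  move=> t t01; apply: cm_uptoM => //.
  apply: cm_uptoM; first exact: cm_upto_cst.
  rewrite -[r - 1]opprB; apply: cm_upto_powRN; last by rewrite subr_ge0.
  exact: bernstein_interp.
by apply: eq_cm_upto => k; rewrite /f mul0r addr0 mul1r [a k + _]addrC subrK.
Qed.

Lemma iter_backdiff_sum n c m :
  iter n backdiff c m = \sum_(0 <= j < n.+1) (-1) ^+ j * 'C(n, j)%:R * c (m + j)%N.
Proof.
elim: n m => [|n IHn] m; first by rewrite big_nat1 bin0 expr0 !mul1r addn0.
rewrite iter_backdiffE !IHn [in RHS]big_nat_recl // bin0 expr0 !mul1r addn0.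
rewrite [X in X - _]big_nat_recl // bin0 expr0 !mul1r addn0 -addrA; congr +%R.
rewrite [X in _ = X](eq_bigr (fun j =>
  (-1) ^+ j.+1 * 'C(n, j.+1)%:R * c (m + j.+1)%N
   - (-1) ^+ j * 'C(n, j)%:R * c (m.+1 + j)%N)); last first.
  by move=> j _; rewrite binS natrD addnS addSn exprS; ring.
rewrite sumrB; congr (_ - _).
by rewrite big_nat_recr //= bin_small // mulr0 mul0r addr0.
Qed.

Lemma bernstein_of_alternating a : completely_alternating a -> bernstein_seq a.
Proof.
move=> [a_gt0 alt]; split=> // n; apply/cm_uptoP => k _ m.
have -> : iter k backdiff (fun m => a m.+1 - a m) m = - iter k.+1 backdiff a m.
  by elim: k m => [|k IHk] m; rewrite ?iter_backdiffE ?IHk /= /backdiff; ring.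
by rewrite oppr_ge0 iter_backdiff_sum; exact: alt.
Qed.

(** 1 / (a^p + a^q) = a^(-p) (1 + a^(q-p))^(-1) is a product of two negative powers
    of Bernstein sequences. *)
Lemma cm_inv_sum_powR a p q : bernstein_seq a -> 0 < p -> p <= q -> q <= p + 1 ->
  completely_monotone (fun m => (a m `^ p + a m `^ q)^-1).
Proof.
move=> a_bern p_gt0 p_q q_p n; have [a_gt0 _] := a_bern.
have r01 : 0 <= q - p <= 1 by rewrite subr_ge0 p_q lerBlDl.
have [r_gt0 dr] := bernstein_powR a_bern r01.
have b_bern : bernstein_seq (fun m => 1 + a m `^ (q - p)).
  split=> [m|k]; first by rewrite addr_gt0.
  by apply: eq_cm_upto (dr k) => m; ring.
have := cm_uptoM (cm_upto_powRN n a_bern (ltW p_gt0)) (cm_upto_powRN n b_bern ler01).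
apply: eq_cm_upto => m; rewrite powR_inv1; last by rewrite addr_ge0 ?ltW.
rewrite powRN -invfM mulrDr mulr1 -powRD ?(addrC p) ?subrK //.
by apply/implyP => _; rewrite gt_eqF.
Qed.

End CompletelyMonotone.

(** * Limits of complex sequences *)

Section ComplexLimits.
Variable R : realType.
Local Notation C := (cplx R).
Implicit Types (u v : nat -> C) (l z : C).

(** The embedding of the reals, with the type [cplx R] that carries the norm
    topology as its codomain. *)
Definition toC (x : R) : C := real_complex R x.

Lemma toC_is_zmod_morphism : zmod_morphism toC.
Proof. exact: (rmorphB (real_complex R)). Qed.

Lemma toC_is_monoid_morphism : monoid_morphism toC.
Proof. by split; [exact: rmorph1|exact: (rmorphM (real_complex R))]. Qed.

HB.instance Definition _ := GRing.isZmodMorphism.Build R C toC toC_is_zmod_morphism.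
HB.instance Definition _ := GRing.isMonoidMorphism.Build R C toC toC_is_monoid_morphism.

Lemma toCM (x y : R) : toC (x * y) = toC x * toC y.
Proof. exact: rmorphM. Qed.

Lemma toCX (x : R) n : toC (x ^+ n) = toC x ^+ n.
Proof. exact: rmorphXn. Qed.

Lemma toC_ge0 (x : R) : (0 <= toC x) = (0 <= x).
Proof. exact: ler0c. Qed.

Lemma toC_gt0 (x : R) : (0 < toC x) = (0 < x).
Proof. exact: (ltcR 0 x). Qed.

Lemma ler_toC (x y : R) : (toC x <= toC y) = (x <= y).
Proof. exact: lecR. Qed.

Lemma ltr_toC (x y : R) : (toC x < toC y) = (x < y).
Proof. exact: ltcR. Qed.

Lemma conj_toC (x : R) : (toC x)^* = toC x.
Proof. by apply/CrealP; rewrite complex_real. Qed.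

Lemma ge0_toC (z : C) : 0 <= z -> z = toC (complex.Re z).
Proof. by move=> z_ge0; rewrite /toC RRe_real // ger0_real. Qed.

Lemma normC_toC (x : R) : `|toC x| = toC `|x|.
Proof.
rewrite /toC normc_def /=; congr (_%:C)%C.
by rewrite expr0n addr0 sqrtr_sqr.
Qed.

Lemma normRe_le z : toC `|complex.Re z| <= `|z|.
Proof.
rewrite normc_def /toC lecR -sqrtr_sqr ler_wsqrtr // lerDl.
exact: sqr_ge0.
Qed.

Lemma normIm_le z : toC `|complex.Im z| <= `|z|.
Proof.
rewrite normc_def /toC lecR -sqrtr_sqr ler_wsqrtr // lerDr.
exact: sqr_ge0.
Qed.

Lemma normC_leD z : `|z| <= toC (`|complex.Re z| + `|complex.Im z|).
Proof.
rewrite [leLHS](_ : _ = `|toC (complex.Re z) + 'i * toC (complex.Im z)|).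
  apply: le_trans (ler_normD _ _) _.
  by rewrite normrM normCi mul1r !normC_toC rmorphD.
by congr `|_|; exact: complexE.
Qed.

Lemma cvgC_real (u : nat -> R) (l : R) :
  u @ \oo --> l -> (fun n => toC (u n)) @ \oo --> toC l.
Proof.
move=> /cvgrPdist_lt ul; apply/cvgrPdist_lt => e e_gt0.
have [x ex] : exists x, e = toC x by exists (complex.Re e); exact/ge0_toC/ltW.
have x_gt0 : 0 < x by rewrite -ltr_toC -ex.
near=> n; rewrite -rmorphB normC_toC ex ltr_toC.
by near: n; exact: ul.
Unshelve. all: by end_near. Qed.

Lemma cvgC_Re u l : u @ \oo --> l -> (fun n => complex.Re (u n)) @ \oo --> complex.Re l.
Proof.
move=> /cvgrPdist_lt ul; apply/cvgrPdist_lt => e e_gt0.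
near=> n; rewrite -raddfB -ltr_toC; apply: le_lt_trans (normRe_le _) _.
by near: n; apply: ul; rewrite ltr_toC.
Unshelve. all: by end_near. Qed.

Lemma cvgC_Im u l : u @ \oo --> l -> (fun n => complex.Im (u n)) @ \oo --> complex.Im l.
Proof.
move=> /cvgrPdist_lt ul; apply/cvgrPdist_lt => e e_gt0.
near=> n; rewrite -raddfB -ltr_toC; apply: le_lt_trans (normIm_le _) _.
by near: n; apply: ul; rewrite ltr_toC.
Unshelve. all: by end_near. Qed.

Lemma cvgC_ge0 u l : (forall n, 0 <= u n) -> u @ \oo --> l -> 0 <= l.
Proof.
move=> u_ge0 ul; rewrite lecE /=; apply/andP; split.
  rewrite -(cvg_lim (@Rhausdorff R) (cvgC_Im ul)) (_ : (fun n => _) = fun=> 0).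
    by rewrite lim_cst.
  by apply/funext => n; rewrite (ge0_toC (u_ge0 n)).
have : (fun n => complex.Re (u n)) @ \oo --> complex.Re l by exact: cvgC_Re.
move=> cR; rewrite -(cvg_lim (@Rhausdorff R) cR).
apply: limr_ge; first by apply/cvg_ex; exists (complex.Re l).
by near=> n; rewrite -toC_ge0 -ge0_toC.
Unshelve. all: by end_near. Qed.

Lemma cvgC_conj u l : u @ \oo --> l -> (fun n => (u n)^*) @ \oo --> l^*.
Proof.
move=> /cvgrPdist_lt ul; apply/cvgrPdist_lt => e e_gt0.
near=> n; rewrite -rmorphB norm_conjC.
by near: n; exact: ul.
Unshelve. all: by end_near. Qed.

Lemma cvgC_complete u :
  (forall e : C, 0 < e ->
     exists N, forall m n, (N <= m)%N -> (N <= n)%N -> `|u m - u n| < e) ->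
  exists l, u @ \oo --> l.
Proof.
move=> cau.
have cvgR (f : C -> R) : {morph f : x y / x - y} ->
    (forall z, toC `|f z| <= `|z|) -> cvgn (fun n => f (u n)).
  move=> fB f_le; apply/cauchy_cvgP; apply: cauchy_exP => e e_gt0.
  have [|N uN] := cau (toC e); first by rewrite ltr_toC.
  exists (f (u N)); exists N => // n /= Nn.
  rewrite /ball/= -fB -ltr_toC.
  exact: le_lt_trans (f_le _) (uN _ _ _ _).
have /cvg_ex [a ua] := cvgR (@complex.Re R) (raddfB (@complex.Re R)) normRe_le.
have /cvg_ex [b ub] := cvgR (@complex.Im R) (raddfB (@complex.Im R)) normIm_le.
exists (Complex a b); apply/cvgrPdist_lt => e e_gt0.
have [x ex] : exists x, e = toC x by exists (complex.Re e); exact/ge0_toC/ltW.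
have x_gt0 : 0 < x by rewrite -ltr_toC -ex.
have x2_gt0 : 0 < x / 2 by rewrite divr_gt0.
near=> n; apply: le_lt_trans (normC_leD _) _; rewrite ex ltr_toC !raddfB /=.
rewrite [ltRHS]splitr ltrD //.
  by near: n; move/cvgrPdist_lt : ua; exact.
by near: n; move/cvgrPdist_lt : ub; exact.
Unshelve. all: by end_near. Qed.

Lemma cvgC_sum (I : Type) (r : seq I) (P : pred I) (F : I -> nat -> C) (L : I -> C) :
  (forall i, P i -> F i @ \oo --> L i) ->
  (fun n => \sum_(i <- r | P i) F i n) @ \oo --> \sum_(i <- r | P i) L i.
Proof.
move=> FL; elim: r => [|i r IHr].
  rewrite big_nil (_ : (fun n => _) = fun=> 0); first exact: cvg_cst.
  by apply/funext => n; rewrite big_nil.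
have [Pi|nPi] := boolP (P i); last first.
  rewrite big_cons (negbTE nPi) (_ : (fun n => _) = (fun n => \sum_(j <- r | P j) F j n)) //.
  by apply/funext => n; rewrite big_cons (negbTE nPi).
rewrite big_cons Pi (_ : (fun n => _) = (fun n => F i n + \sum_(j <- r | P j) F j n)).
  exact: (cvgD (FL i Pi) IHr).
by apply/funext => n; rewrite big_cons Pi.
Qed.

(** The archimedean property, for a positive element of the complex numbers. *)
Lemma invS_lt_eps (e : C) : 0 < e ->
  exists N, forall n, (N <= n)%N -> n.+1%:R^-1 < e.
Proof.
move=> e_gt0.
have [x ex] : exists x, e = toC x by exists (complex.Re e); exact/ge0_toC/ltW.
have x_gt0 : 0 < x by rewrite -ltr_toC -ex.
have [N _ hN] : \forall n \near \oo, n.+1%:R^-1 < x.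
  exact: near_infty_natSinv_lt (PosNum x_gt0).
exists N => n Nn; rewrite ex -(rmorph_nat toC) -fmorphV ltr_toC.
exact: hN.
Qed.

Lemma cvgC_of_dist (f : nat -> C) (l : C) :
  (forall e, 0 < e -> exists N, forall n, (N <= n)%N -> `|l - f n| < e) ->
  f @ \oo --> l.
Proof.
move=> h; apply/cvgrPdist_lt => e /h [N hN].
by exists N => // n /= /hN.
Qed.

Lemma cvgC_dist (f : nat -> C) (l : C) : f @ \oo --> l ->
  forall e, 0 < e -> exists N, forall n, (N <= n)%N -> `|l - f n| < e.
Proof.
move=> /cvgrPdist_lt h e /h [N _ hN].
by exists N => n /hN.
Qed.

Lemma cvgC_unique (f : nat -> C) (l l' : C) : f @ \oo --> l -> f @ \oo --> l' -> l = l'.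
Proof. exact: cvg_unique. Qed.

Lemma cvgC_norm_le u (l M : C) N :
  u @ \oo --> l -> (forall n, (N <= n)%N -> `|u n| <= M) -> `|l| <= M.
Proof.
move=> ul uM; apply/ler_addgt0Pr => eps eps_gt0.
have [N' hN'] := cvgC_dist ul eps_gt0.
rewrite -(subrK (u (maxn N N')) l) addrC.
apply: le_trans (ler_normD _ _) _; apply: lerD.
  by apply: uM; exact: leq_maxl.
by apply/ltW/hN'; exact: leq_maxr.
Qed.

End ComplexLimits.

(** * Hausdorff moments and positive definite kernels *)

Section Hausdorff.
Variable R : realType.
Implicit Types (c : nat -> R) (n m k : nat).

(** The mass at k/n of the n-th discrete approximation of the measure with moments
    c: it is the integral of the Bernstein polynomial of index (n, k). *)
Definition bernstein_weight c n k : R :=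
  'C(n, k)%:R * iter (n - k) (@backdiff R) c k.

Lemma bernstein_weight_ge0 c n k : completely_monotone c ->
  0 <= bernstein_weight c n k.
Proof.
move=> cc; rewrite mulr_ge0 //.
by move/cm_uptoP: (cc (n - k)%N); exact.
Qed.

Lemma bernstein_weightS c n k : (k <= n)%N ->
  bernstein_weight c n.+1 k.+1 =
  bernstein_weight (shift_seq c) n k + 'C(n, k.+1)%:R * iter (n - k) (@backdiff R) c k.+1.
Proof.
move=> k_n; rewrite /bernstein_weight subSS binS natrD mulrDl addrC.
by rewrite iter_backdiff_shift.
Qed.

(** The factorial moments of the discrete approximation are exact: binomials in x
    are reproduced by Bernstein polynomials. Pascal's rule gives the induction. *)
Lemma sum_bernstein_weight c n m :
  \sum_(k < n.+1) bernstein_weight c n k * 'C(k, m)%:R = 'C(n, m)%:R * c m.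
Proof.
elim: n m c => [|n IHn] m c.
  rewrite big_ord1 /bernstein_weight subn0 bin0 mul1r /=.
  by case: m => [|m]; rewrite !bin0n ?mulr1 ?mul1r ?mulr0 ?mul0r.
have lower : \sum_(k < n.+2) 'C(n, k)%:R * iter (n.+1 - k) (@backdiff R) c k * 'C(k, m)%:R
    = 'C(n, m)%:R * backdiff c m.
  rewrite big_ord_recr /= bin_small // !mul0r addr0 -IHn.
  apply: eq_bigr => k _; rewrite /bernstein_weight subSn ?iterSr //.
  by rewrite -ltnS.
rewrite (eq_bigr (fun k : 'I_n.+2 =>
    'C(n, k)%:R * iter (n.+1 - k) (@backdiff R) c k * 'C(k, m)%:R
    + (if (k : nat) is k'.+1 then bernstein_weight (shift_seq c) n k' * 'C(k, m)%:R else 0)));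
  last first.
  case=> [[|k] k_n] _ /=; first by rewrite /bernstein_weight !bin0 addr0.
  by rewrite bernstein_weightS // mulrDl addrC subSS.
rewrite big_split /= lower [X in _ + X]big_ord_recl /= add0r.
case: m {lower} => [|m].
  under eq_bigr => k _ do rewrite add0n bin0 -(bin0 k).
  by rewrite IHn !bin0 !mul1r /backdiff /shift_seq subrK.
under eq_bigr do rewrite /bump /= add1n add0n binS natrD mulrDr.
rewrite big_split /= !IHn binS natrD /backdiff /shift_seq; ring.
Qed.

(** Passing from m to m + 1 multiplies the ratio of binomials by (k - m) / (n - m),
    which differs from k / n by at most m / (n - m). *)
Lemma bin_ratio_close m n k : (m < n)%N -> (k <= n)%N ->
  `|'C(k, m)%:R / 'C(n, m)%:R - (k%:R / n%:R) ^+ m| <= m%:R ^+ 2 / (n - m)%:R :> R.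
Proof.
elim: m => [|m IHm] m_n k_n.
  by rewrite !bin0 divr1 expr0 subrr normr0 expr0n /= mul0r.
have n_gt0 : 0 < n%:R :> R by rewrite ltr0n; lia.
have nm_gt0 : 0 < (n - m)%:R :> R by rewrite ltr0n; lia.
have nm1_gt0 : 0 < (n - m.+1)%:R :> R by rewrite ltr0n; lia.
have x_ge0 : 0 <= k%:R / n%:R :> R by rewrite divr_ge0.
have x_le1 : k%:R / n%:R <= 1 :> R by rewrite ler_pdivrMr // mul1r ler_nat.
pose P : R := 'C(k, m)%:R / 'C(n, m)%:R.
pose f : R := (k - m)%:R / (n - m)%:R.
have Cnm_gt0 : 0 < 'C(n, m)%:R :> R by rewrite ltr0n bin_gt0; lia.
have P_ge0 : 0 <= P by rewrite divr_ge0.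
have P_le1 : P <= 1.
  by rewrite ler_pdivrMr // mul1r ler_nat leq_bin2l.
have ES : 'C(k, m.+1)%:R / 'C(n, m.+1)%:R = P * f.
  have m1 : m.+1%:R != 0 :> R by rewrite pnatr_eq0.
  have e1 : 'C(k, m.+1)%:R = (k - m)%:R * 'C(k, m)%:R / m.+1%:R :> R.
    by rewrite -natrM -mul_bin_left natrM mulrC mulKf.
  have e2 : 'C(n, m.+1)%:R = (n - m)%:R * 'C(n, m)%:R / m.+1%:R :> R.
    by rewrite -natrM -mul_bin_left natrM mulrC mulKf.
  rewrite e1 e2 /P /f; field.
  by rewrite (gt_eqF Cnm_gt0) (gt_eqF nm_gt0) addrC natr1.
have Pf : `|P * (f - k%:R / n%:R)| <= m%:R / (n - m)%:R.
  have [km|mk] := ltnP k m.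
    by rewrite /P bin_small // !mul0r normr0 divr_ge0.
  rewrite normrM (ger0_norm P_ge0).
  apply: le_trans (ler_piMl (normr_ge0 _) P_le1) _.
  have -> : f - k%:R / n%:R = - (m%:R * ((n - k)%:R / n%:R) / (n - m)%:R).
    rewrite /f !natrB //; last by lia.
    field; rewrite (gt_eqF n_gt0) /=.
    by rewrite -natrB ?(gt_eqF nm_gt0) //; lia.
  rewrite normrN ger0_norm; last by rewrite !(mulr_ge0, divr_ge0, invr_ge0).
  rewrite ler_pM2r ?invr_gt0 // ler_piMr // ler_pdivrMr // mul1r ler_nat.
  exact: leq_subr.
rewrite ES exprS.
have -> : P * f - k%:R / n%:R * (k%:R / n%:R) ^+ m =
  P * (f - k%:R / n%:R) + k%:R / n%:R * (P - (k%:R / n%:R) ^+ m) by ring.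
apply: le_trans (ler_normD _ _) _.
have step : m%:R / (n - m)%:R + m%:R ^+ 2 / (n - m)%:R <= m.+1%:R ^+ 2 / (n - m.+1)%:R :> R.
  rewrite -mulrDl; apply: ler_pM.
  - by rewrite addr_ge0 // exprn_ge0.
  - by rewrite invr_ge0.
  - by rewrite -natrX -natrD -natrX ler_nat; nia.
  - by rewrite lef_pV2 ?posrE // ler_nat; lia.
apply: le_trans step; apply: lerD => //.
rewrite normrM (ger0_norm x_ge0).
apply: le_trans (ler_piMl (normr_ge0 _) x_le1) _.
by apply: IHm => //; lia.
Qed.

(** A weak form of Hausdorff's theorem. Power moments differ from the exact
    factorial moments by O(1/n), uniformly in k. *)
Lemma cvg_bernstein_moment c m : completely_monotone c ->
  (fun n => \sum_(k < n.+1) bernstein_weight c n k * (k%:R / n%:R) ^+ m) @ \oo --> c m.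
Proof.
move=> cc; apply/cvgrPdist_le => e e_gt0.
have c0_ge0 : 0 <= c 0%N := cm_upto_ge0 (cc 0%N) 0%N.
near=> n.
have m_n : (m < n)%N by near: n; exact: nbhs_infty_gt.
have nm_gt0 : 0 < (n - m)%:R :> R by rewrite ltr0n subn_gt0.
have Cnm_gt0 : 0 < 'C(n, m)%:R :> R by rewrite ltr0n bin_gt0 ltnW.
have -> : c m = \sum_(k < n.+1) bernstein_weight c n k * ('C(k, m)%:R / 'C(n, m)%:R).
  under eq_bigr do rewrite mulrA.
  by rewrite -mulr_suml sum_bernstein_weight mulrC mulKf // gt_eqF.
rewrite -sumrB; apply: le_trans (ler_norm_sum _ _ _) _.
apply: (@le_trans _ _ (\sum_(k < n.+1) bernstein_weight c n k * (m%:R ^+ 2 / (n - m)%:R))).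
  apply: ler_sum => k _; rewrite -mulrBr normrM ger0_norm; last exact: bernstein_weight_ge0.
  rewrite ler_wpM2l //; first exact: bernstein_weight_ge0.
  by apply: bin_ratio_close => //; rewrite -ltnS.
rewrite -mulr_suml.
have -> : \sum_(k < n.+1) bernstein_weight c n k = c 0%N.
  have := sum_bernstein_weight c n 0; rewrite bin0 mul1r => <-.
  by under [RHS]eq_bigr do rewrite bin0 mulr1.
rewrite mulrA ler_pdivrMr // mulrC -ler_pdivrMl //.
rewrite natrB ?(ltnW m_n) // lerBrDr.
by near: n; exact: nbhs_infty_ger.
Unshelve. all: by end_near. Qed.

End Hausdorff.

Section PositiveKernels.
Variable R : realType.
Local Notation C := (cplx R).

Definition gram_form (X : Type) (G : X -> X -> C) (s : seq (C * X)) : C :=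
  \sum_(u <- s) \sum_(v <- s) u.1 * v.1^* * G u.2 v.2.

Definition psd (X : Type) (G : X -> X -> C) : Prop := forall s, 0 <= gram_form G s.

Lemma gram_form_map (X Y : Type) (h : X -> Y) (G : Y -> Y -> C) (s : seq (C * X)) :
  gram_form (fun x y => G (h x) (h y)) s = gram_form G [seq (u.1, h u.2) | u <- s].
Proof.
rewrite /gram_form big_map; apply: eq_bigr => u _ /=.
by rewrite big_map.
Qed.

Lemma psd_comp (X Y : Type) (h : X -> Y) (G : Y -> Y -> C) :
  psd G -> psd (fun x y => G (h x) (h y)).
Proof. by move=> G_psd s; rewrite gram_form_map. Qed.

(** Grouping the points by the value of D turns the form into a sum of squared
    moduli. *)
Lemma psd_block (X T : eqType) (D : X -> T) (g : X -> C) :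
  psd (fun x y => if D x == D y then g x * (g y)^* else 0).
Proof.
move=> s; pose a (u : C * X) := u.1 * g u.2.
have -> : gram_form (fun x y => if D x == D y then g x * (g y)^* else 0) s =
    \sum_(t <- undup [seq D u.2 | u <- s])
      (\sum_(u <- s | D u.2 == t) a u) * (\sum_(u <- s | D u.2 == t) a u)^*.
  have square t : (\sum_(u <- s | D u.2 == t) a u) * (\sum_(u <- s | D u.2 == t) a u)^* =
      \sum_(u <- s | D u.2 == t) \sum_(v <- s | D v.2 == t) a u * (a v)^*.
    by rewrite rmorph_sum mulr_suml; apply: eq_bigr => u _; rewrite mulr_sumr.
  under [RHS]eq_bigr do rewrite square.
  rewrite /= (exchange_big_dep xpredT) //=; rewrite /gram_form.
  apply: eq_big_seq => u us.
  under [RHS]eq_bigl do rewrite eq_sym.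
  rewrite -big_filter filter_pred1_uniq ?undup_uniq ?mem_undup ?big_seq1;
    last exact: (map_f (fun u : C * X => D u.2)).
  rewrite [RHS]big_mkcond; apply: eq_bigr => v _.
  rewrite eq_sym; case: ifP => _; last by rewrite mulr0.
  by rewrite /a rmorphM; ring.
  exact: isT.
apply: sumr_ge0 => t _.
by rewrite -normCK exprn_ge0.
Qed.

(** The inner product of z^x.1 conj(z)^x.2 and z^y.1 conj(z)^y.2 for a rotation
    invariant measure on the disc such that |z|^(2m) has integral c m. *)
Definition moment_kernel (c : nat -> R) (x y : nat * nat) : C :=
  if (x.1 + y.2 == y.1 + x.2)%N then toC (c (x.1 + y.2)%N) else 0.

(** Here the measure is the uniform one on the circle of radius r = sqrt t: the
    functions are r^(k+i) times the character of index k - i. *)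
Lemma psd_power_kernel (t : R) : 0 <= t -> psd (moment_kernel (fun m => t ^+ m)).
Proof.
move=> t_ge0 s.
pose r := Num.sqrt t.
have := psd_block (fun x : nat * nat => x.1%:Z - x.2%:Z) (fun x => toC (r ^+ (x.1 + x.2))) s.
congr (0 <= _); apply: eq_bigr => u _; apply: eq_bigr => v _; congr (_ * _).
rewrite /moment_kernel conj_toC -rmorphM.
have -> : (u.2.1%:Z - u.2.2%:Z == v.2.1%:Z - v.2.2%:Z) = (u.2.1 + v.2.2 == v.2.1 + u.2.2)%N.
  by rewrite subr_eq addrAC eq_sym subr_eq eq_sym -!PoszD eqz_nat.
case: eqP => // e; congr toC.
rewrite -exprD -{1}(sqr_sqrtr t_ge0) -/r -exprM; congr (_ ^+ _).
by case: u v e => [_ [k i]] [_ [l j]] /=; lia.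
Qed.

(** Positive combinations and limits of the kernels of circles. *)
Lemma psd_moment_kernel (c : nat -> R) : completely_monotone c -> psd (moment_kernel c).
Proof.
move=> cc s.
pose K n : nat * nat -> nat * nat -> C := fun x y =>
  \sum_(k < n.+1) toC (bernstein_weight c n k) * moment_kernel (fun m => (k%:R / n%:R) ^+ m) x y.
apply: (@cvgC_ge0 R (fun n => gram_form (K n) s)).
  move=> n; rewrite /gram_form.
  rewrite (_ : \sum_(u <- s) _ = \sum_(k < n.+1) toC (bernstein_weight c n k) *
     gram_form (moment_kernel (fun m => (k%:R / n%:R) ^+ m)) s).
    apply: sumr_ge0 => k _; rewrite mulr_ge0 ?toC_ge0 ?bernstein_weight_ge0 //.
    by apply: psd_power_kernel; rewrite divr_ge0.
  rewrite /gram_form; under [RHS]eq_bigr do rewrite mulr_sumr.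
  rewrite [RHS]exchange_big /=; apply: eq_bigr => u _.
  under [RHS]eq_bigr do rewrite mulr_sumr.
  rewrite [RHS]exchange_big /=; apply: eq_bigr => v _.
  rewrite mulr_sumr; apply: eq_bigr => k _; ring.
apply: cvgC_sum => u _.
apply: cvgC_sum => v _.
apply: cvgMl_tmp.
rewrite /K /moment_kernel; case: eqP => e.
  rewrite (_ : (fun n => _) = (fun n => toC (\sum_(k < n.+1)
      bernstein_weight c n k * (k%:R / n%:R) ^+ (u.2.1 + v.2.2)%N))).
    exact: cvgC_real (cvg_bernstein_moment cc).
  apply/funext => n; rewrite rmorph_sum; apply: eq_bigr => k _.
  by rewrite rmorphM.
rewrite (_ : (fun n => _) = fun=> 0); first exact: cvg_cst.
by apply/funext => n; rewrite big1 // => k _; rewrite mulr0.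
Qed.

(** Multiplication by z does not increase norms: the difference of Gram matrices is
    the moment kernel of the difference of c. *)
Lemma psd_moment_kernel_diff (c : nat -> R) : completely_monotone c ->
  psd (fun x y => moment_kernel c x y - moment_kernel c (x.1.+1, x.2) (y.1.+1, y.2)).
Proof.
move=> cc s; have := psd_moment_kernel (cm_backdiff cc) s.
congr (0 <= _); apply: eq_bigr => u _; apply: eq_bigr => v _; congr (_ * _).
rewrite /moment_kernel /= !addSn eqSS; case: ifP => _; last by rewrite subr0.
by rewrite -rmorphB.
Qed.

End PositiveKernels.

(** * Semi-inner products *)

Record semi_inner (R : realType) (E : lmodType (cplx R)) := SemiInner {
  sform :> E -> E -> cplx R ;
  sformP : forall a u v w, sform (a *: u + v) w = a * sform u w + sform v w ;
  sformC : forall u v, sform u v = (sform v u)^* ;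
  sform_ge0 : forall u, 0 <= sform u u }.

Section SemiInnerTheory.
Variables (R : realType) (E : lmodType (cplx R)) (s : semi_inner E).
Local Notation C := (cplx R).
Implicit Types (u v w : E) (a : C).

Lemma sformDl u v w : s (u + v) w = s u w + s v w.
Proof. by rewrite -{1}[u]scale1r sformP mul1r. Qed.

Lemma sform0l w : s 0 w = 0.
Proof.
have := sformDl 0 0 w; rewrite addr0 => /eqP.
by rewrite -subr_eq subrr eq_sym => /eqP.
Qed.

Lemma sformZl a u w : s (a *: u) w = a * s u w.
Proof. by rewrite -{1}[a *: u]addr0 sformP sform0l addr0. Qed.

Lemma sformNl u w : s (- u) w = - s u w.
Proof. by rewrite -scaleN1r sformZl mulN1r. Qed.

Lemma sformBl u v w : s (u - v) w = s u w - s v w.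
Proof. by rewrite sformDl sformNl. Qed.

Lemma sformDr u v w : s w (u + v) = s w u + s w v.
Proof. by rewrite sformC sformDl rmorphD /= -!sformC. Qed.

Lemma sformZr a u w : s w (a *: u) = a^* * s w u.
Proof. by rewrite sformC sformZl rmorphM /= -sformC. Qed.

Lemma sformBr u v w : s w (u - v) = s w u - s w v.
Proof. by rewrite sformC sformBl rmorphB /= -!sformC. Qed.

(** The form is nonnegative at u - a v. If v is isotropic, taking for a a large
    multiple of s u v shows that s u v vanishes; otherwise the choice a = s u v / s
    v v is optimal. *)
Lemma sform_CS2 u v : `|s u v| ^+ 2 <= s u u * s v v.
Proof.
have expand a : s (u - a *: v) (u - a *: v) =
    s u u - a^* * s u v - a * (s u v)^* + a * a^* * s v v.
  by rewrite sformBl !sformBr !sformZl !sformZr -(sformC s v u); ring.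
have pos a : 0 <= s u u - a^* * s u v - a * (s u v)^* + a * a^* * s v v.
  by rewrite -expand sform_ge0.
have := sform_ge0 s v; rewrite le_eqVlt => /predU1P[v0|v_gt0].
  have [->|uv0] := eqVneq (s u v) 0.
    by rewrite normr0 expr0n /= -v0 mulr0.
  have N_gt0 : 0 < `|s u v| ^+ 2 by rewrite exprn_gt0 // normr_gt0.
  (* with a = t (s u v), the form takes the value s u u - 2 t |s u v|^2 = -1 *)
  pose t : C := (s u u + 1) / (2 * `|s u v| ^+ 2).
  have t_ge0 : 0 <= t.
    by rewrite divr_ge0 ?mulr_ge0 ?addr_ge0 ?ler01 ?sform_ge0 ?exprn_ge0.
  have /CrealP t_real : t \is Num.real by rewrite ger0_real.
  have := pos (t * s u v); rewrite -v0 mulr0 addr0 rmorphM /= t_real.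
  have -> : s u u - t * (s u v)^* * s u v - t * s u v * (s u v)^* = -1.
    rewrite (_ : _ - _ - _ = s u u - t * (2 * (s u v * (s u v)^*))); last by ring.
    rewrite -normCK /t divfK ?mulf_neq0 ?pnatr_eq0 ?normr_eq0 //; ring.
  by rewrite ler0N1.
have := pos (s u v / s v v); rewrite rmorphM fmorphV /= -(sformC s v v).
have -> : s u u - (s u v)^* / s v v * s u v - s u v / s v v * (s u v)^*
   + s u v / s v v * ((s u v)^* / s v v) * s v v = s u u - s u v * (s u v)^* / s v v.
  by field; rewrite gt_eqF.
by rewrite -normCK subr_ge0 ler_pdivrMr.
Qed.

Definition snorm u : C := sqrtC (s u u).

Lemma snorm_ge0 u : 0 <= snorm u.
Proof. by rewrite sqrtC_ge0 sform_ge0. Qed.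

Lemma snormK u : snorm u ^+ 2 = s u u.
Proof. exact: sqrtCK. Qed.

Lemma sform_CS u v : `|s u v| <= snorm u * snorm v.
Proof.
rewrite -(@ler_pXn2r _ 2) ?nnegrE ?mulr_ge0 ?snorm_ge0 //.
by rewrite exprMn !snormK sform_CS2.
Qed.

Lemma snormZ a u : snorm (a *: u) = `|a| * snorm u.
Proof.
by rewrite /snorm sformZl sformZr mulrA -normCK rootCMl ?exprn_ge0 // sqrCK.
Qed.

Lemma snormN u : snorm (- u) = snorm u.
Proof. by rewrite -scaleN1r snormZ normrN1 mul1r. Qed.

Lemma snormD u v : snorm (u + v) <= snorm u + snorm v.
Proof.
rewrite -(@ler_pXn2r _ 2) ?nnegrE ?addr_ge0 ?snorm_ge0 //.
rewrite snormK sformDl !sformDr sqrrD !snormK -addrA -[leRHS]addrA lerD2l.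
rewrite addrA lerD2r (sformC s v u).
apply: (@le_trans _ _ `|s u v + (s u v)^*|).
  apply: real_ler_norm; rewrite CrealE rmorphD /= conjCK addrC //.
apply: le_trans (ler_normD _ _) _; rewrite norm_conjC -mulr2n.
by rewrite lerMn2r /= sform_CS.
Qed.

Lemma snorm_eq0 u : snorm u = 0 -> forall w, s u w = 0.
Proof.
move=> u0 w; apply/eqP; rewrite -normr_le0.
by have := sform_CS u w; rewrite u0 mul0r.
Qed.

End SemiInnerTheory.

(** * Completion of a semi-inner product space *)

Section Completion.
Variables (R : realType) (E : lmodType (cplx R)) (s : semi_inner E).
Local Notation C := (cplx R).
Implicit Types (u v w x y : nat -> E) (F G : E -> C^o) (a : C).

Definition form_cauchy u : Prop := forall e : C, 0 < e ->
  exists N, forall m n, (N <= m)%N -> (N <= n)%N -> snorm s (u m - u n) < e.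

(** In the completion, a Cauchy sequence u is identified with the functional w |->
    lim s (u n) w that it defines. Equivalent sequences define the same functional,
    so the completion is a space of functions on E rather than a quotient. *)
Definition represents u F : Prop :=
  form_cauchy u /\ forall w : E, (fun n => s (u n) w) @ \oo --> (F w : C).

Definition form_null u : Prop := forall e : C, 0 < e ->
  exists N, forall n, (N <= n)%N -> snorm s (u n) < e.

Lemma form_cauchy_bounded u : form_cauchy u ->
  exists M : C, 0 < M /\ exists N, forall n, (N <= n)%N -> snorm s (u n) <= M.
Proof.
move=> /(_ 1 ltr01) [N uN]; exists (snorm s (u N) + 1); split.
  by rewrite ltr_wpDl ?ltr01 ?snorm_ge0.
exists N => n Nn; rewrite -(subrK (u N) (u n)) addrC.
apply: le_trans (snormD _ _ _) _; rewrite lerD2l //.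
exact/ltW/uN.
Qed.

Lemma form_null_sform x y : form_null x -> form_cauchy y ->
  (fun n => s (x n) (y n)) @ \oo --> (0 : C).
Proof.
move=> x0 /form_cauchy_bounded [M [M_gt0 [N yM]]]; apply: cvgC_of_dist => e e_gt0.
have [N' xN'] := x0 (e / M) (divr_gt0 e_gt0 M_gt0).
exists (maxn N N') => n; rewrite geq_max => /andP[Nn N'n].
rewrite sub0r normrN; apply: le_lt_trans (sform_CS _ _ _) _.
apply: (@le_lt_trans _ _ (snorm s (x n) * M)).
  by rewrite ler_wpM2l ?snorm_ge0 // yM.
by rewrite -ltr_pdivlMr // xN'.
Qed.

Lemma represents_lin a u v F G : represents u F -> represents v G ->
  represents (fun n => a *: u n + v n) (a *: F + G).
Proof.
move=> [uc uF] [vc vG]; split.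
  move=> e e_gt0.
  have e2 : 0 < e / 2 by rewrite divr_gt0.
  have e3 : 0 < e / 2 / (`|a| + 1) by rewrite divr_gt0 // ltr_wpDl.
  have [N1 h1] := uc _ e3; have [N2 h2] := vc _ e2.
  exists (maxn N1 N2) => m n; rewrite !geq_max => /andP[m1 m2] /andP[n1 n2].
  have -> : a *: u m + v m - (a *: u n + v n) = a *: (u m - u n) + (v m - v n).
    by rewrite scalerBr opprD addrACA.
  apply: le_lt_trans (snormD _ _ _) _; rewrite snormZ [ltRHS]splitr.
  apply: ler_ltD; last exact: h2.
  apply: (@le_trans _ _ (`|a| * (e / 2 / (`|a| + 1)))).
    by rewrite ler_wpM2l // ltW // h1.
  rewrite mulrCA ler_piMr ?(ltW e2) // ler_pdivrMr ?mul1r ?lerDl //.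
move=> w.
have -> : (fun n => s (a *: u n + v n) w) = (fun n => a * s (u n) w + s (v n) w).
  by apply/funext => n; rewrite sformP.
have aF : (fun n => a * s (u n) w) @ \oo --> (a * F w : C) by exact: cvgMl_tmp (uF w).
exact: (cvgD aF (vG w)).
Qed.

Lemma form_cauchy_lim u : form_cauchy u -> exists F, represents u F.
Proof.
move=> uc; suff /choice [F uF] : forall w : E, exists l : C, (fun n => s (u n) w) @ \oo --> l.
  by exists F; split.
move=> w; apply: cvgC_complete => e e_gt0.
have w_gt0 : 0 < snorm s w + 1 by rewrite ltr_wpDl ?snorm_ge0.
have [N uN] := uc _ (divr_gt0 e_gt0 w_gt0); exists N => m n Nm Nn.
rewrite -sformBl; apply: le_lt_trans (sform_CS _ _ _) _.
apply: (@le_lt_trans _ _ (snorm s (u m - u n) * (snorm s w + 1))).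
  by rewrite ler_wpM2l ?snorm_ge0 // lerDl.
by rewrite -ltr_pdivlMr // uN.
Qed.

Lemma form_cauchy_cst (w : E) : form_cauchy (fun=> w).
Proof.
by move=> e e_gt0; exists 0%N => *; rewrite subrr /snorm sform0l sqrtC0.
Qed.

Lemma represents_cst (w : E) : represents (fun=> w) (s w).
Proof. by split; [exact: form_cauchy_cst|move=> v; exact: cvg_cst]. Qed.

(** For fixed m, s (u n) (u n) = s (u n) (u n - u m) + s (u n) (u m); the first term
    is small by the Cauchy property and the second one tends to 0. *)
Lemma represents0_null u : represents u 0 -> form_null u.
Proof.
move=> [uc u0] e e_gt0.
have [M [M_gt0 [N1 uM]]] := form_cauchy_bounded uc.
have e2_gt0 : 0 < e ^+ 2 / 2 by rewrite divr_gt0 ?exprn_gt0.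
have [N2 uN2] := uc _ (divr_gt0 e2_gt0 M_gt0).
pose m := maxn N1 N2.
have [N3 uN3] := cvgC_dist (u0 (u m)) e2_gt0.
exists (maxn m N3) => n; rewrite !geq_max -andbA => /and3P[n1 n2 n3].
rewrite -(@ltr_pXn2r _ 2) ?nnegrE ?snorm_ge0 ?(ltW e_gt0) //.
rewrite snormK -[s (u n) (u n)]ger0_norm ?sform_ge0 //.
have -> : s (u n) (u n) = s (u n) (u n - u m) + s (u n) (u m).
  by rewrite sformBr subrK.
apply: le_lt_trans (ler_normD _ _) _; rewrite [ltRHS]splitr.
apply: ler_ltD; last by have := uN3 n n3; rewrite sub0r normrN.
apply: le_trans (sform_CS _ _ _) _.
apply: (@le_trans _ _ (M * snorm s (u n - u m))).
  by rewrite ler_wpM2r ?snorm_ge0 // uM.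
by rewrite mulrC -ler_pdivlMr // ltW // uN2 // leq_maxr.
Qed.

Lemma representsB_null u v F : represents u F -> represents v F -> form_null (fun n => u n - v n).
Proof.
move=> uF vF; apply: represents0_null.
have := represents_lin (-1) vF uF; rewrite scaleN1r addNr.
by congr represents; apply/funext => n; rewrite scaleN1r addrC.
Qed.

Lemma form_cauchy_sform u v : form_cauchy u -> form_cauchy v ->
  exists l : C, (fun n => s (u n) (v n)) @ \oo --> l.
Proof.
move=> uc vc; apply: cvgC_complete => e e_gt0.
have [M [M_gt0 [N1 uM]]] := form_cauchy_bounded uc.
have [M' [M'_gt0 [N2 vM]]] := form_cauchy_bounded vc.
have e2_gt0 : 0 < e / 2 by rewrite divr_gt0.
have [N3 uN] := uc _ (divr_gt0 e2_gt0 M'_gt0).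
have [N4 vN] := vc _ (divr_gt0 e2_gt0 M_gt0).
exists (maxn (maxn N1 N2) (maxn N3 N4)) => m n.
rewrite !geq_max => /andP[/andP[m1 m2] /andP[m3 m4]] /andP[/andP[n1 n2] /andP[n3 n4]].
have -> : s (u m) (v m) - s (u n) (v n) = s (u m - u n) (v m) + s (u n) (v m - v n).
  by rewrite sformBl sformBr addrA subrK.
apply: le_lt_trans (ler_normD _ _) _; rewrite [ltRHS]splitr.
apply: ltrD; apply: le_lt_trans (sform_CS _ _ _) _.
  apply: (@le_lt_trans _ _ (snorm s (u m - u n) * M')).
    by rewrite ler_wpM2l ?snorm_ge0 // vM.
  by rewrite -ltr_pdivlMr // uN.
apply: (@le_lt_trans _ _ (M * snorm s (v m - v n))).
  by rewrite ler_wpM2r ?snorm_ge0 // uM.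
by rewrite mulrC -ltr_pdivlMr // vN.
Qed.

Definition completion_pred : {pred E -> C^o} := fun F => `[< exists u, represents u F >].

Lemma completion_submod_closed : submod_closed completion_pred.
Proof.
split.
  apply/asboolP; exists (fun=> 0).
  by have := represents_cst 0; congr represents; apply/funext => w; rewrite sform0l.
move=> a F G /asboolP [u uF] /asboolP [v vG]; apply/asboolP.
by exists (fun n => a *: u n + v n); exact: represents_lin.
Qed.

HB.instance Definition _ := GRing.isSubmodClosed.Build _ _ completion_pred
  completion_submod_closed.

Record completion := Completion {
  completion_fun :> E -> C^o ;
  completionP : completion_fun \in completion_pred }.

HB.instance Definition _ := [isSub for completion_fun].
HB.instance Definition _ := gen_eqMixin completion.
HB.instance Definition _ := gen_choiceMixin completion.
HB.instance Definition _ := [SubChoice_isSubLmodule of completion by <:].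

End Completion.

Section CompletionDot.
Variables (R : realType) (E : lmodType (cplx R)) (s : semi_inner E).
Local Notation C := (cplx R).
Local Notation K := (completion s).
Implicit Types (F G : K) (a : C).

Lemma completion_ext F G : (forall w, F w = G w) -> F = G.
Proof. by move=> FG; apply/val_inj/funext. Qed.

Lemma completion_rep_ex F : exists u, represents s u F.
Proof. exact/asboolP/(completionP F). Qed.

Definition rep_seq F : nat -> E := sval (cid (completion_rep_ex F)).

Lemma rep_seqP F : represents s (rep_seq F) F.
Proof. exact: svalP (cid (completion_rep_ex F)). Qed.

Lemma cdot_ex F G : exists l : C, (fun n => s (rep_seq F n) (rep_seq G n)) @ \oo --> l.
Proof. exact: form_cauchy_sform (rep_seqP F).1 (rep_seqP G).1. Qed.

Definition cdot F G : C := sval (cid (cdot_ex F G)).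

(** The inner product does not depend on the chosen representing sequences, since
    two of them differ by a null sequence. *)
Lemma cvg_cdot u v F G : represents s u F -> represents s v G ->
  (fun n => s (u n) (v n)) @ \oo --> cdot F G.
Proof.
move=> uF vG; rewrite /cdot; case: cid => /= l ul.
have du := form_null_sform (representsB_null uF (rep_seqP F)) vG.1.
have dv := cvgC_conj (form_null_sform (representsB_null vG (rep_seqP G)) (rep_seqP F).1).
have sum : (fun n => s (u n - rep_seq F n) (v n) +
    (s (v n - rep_seq G n) (rep_seq F n))^* + s (rep_seq F n) (rep_seq G n)) @ \oo
    --> 0 + 0^* + l.
  exact: cvgD (cvgD du dv) ul.
rewrite conjC0 !add0r in sum.
rewrite (_ : (fun n => s (u n) (v n)) = (fun n => s (u n - rep_seq F n) (v n) +
    (s (v n - rep_seq G n) (rep_seq F n))^* + s (rep_seq F n) (rep_seq G n))); first exact: sum.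
by apply/funext => n; rewrite -sformC sformBl sformBr; ring.
Qed.

Lemma cdot_unique u v F G (l : C) : represents s u F -> represents s v G ->
  (fun n => s (u n) (v n)) @ \oo --> l -> cdot F G = l.
Proof. by move=> uF vG; apply: cvgC_unique; exact: cvg_cdot. Qed.

Lemma represents_linK a u v F G : represents s u F -> represents s v G ->
  represents s (fun n => a *: u n + v n) (a *: F + G : K).
Proof. exact: represents_lin. Qed.

Lemma cdotP a F G H : cdot (a *: F + G) H = a * cdot F H + cdot G H.
Proof.
have FG := represents_linK a (rep_seqP F) (rep_seqP G).
apply: (cdot_unique FG (rep_seqP H)).
have -> : (fun n => s (a *: rep_seq F n + rep_seq G n) (rep_seq H n)) =
    (fun n => a * s (rep_seq F n) (rep_seq H n) + s (rep_seq G n) (rep_seq H n)).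
  by apply/funext => n; rewrite sformP.
have aF : (fun n => a * s (rep_seq F n) (rep_seq H n)) @ \oo --> a * cdot F H.
  exact: cvgMl_tmp (cvg_cdot (rep_seqP F) (rep_seqP H)).
exact: (cvgD aF (cvg_cdot (rep_seqP G) (rep_seqP H))).
Qed.

Lemma cdotC F G : cdot F G = (cdot G F)^*.
Proof.
apply: (cdot_unique (rep_seqP F) (rep_seqP G)).
have := cvgC_conj (cvg_cdot (rep_seqP G) (rep_seqP F)).
by under eq_fun do rewrite -sformC.
Qed.

Lemma cdot_ge0 F : 0 <= cdot F F.
Proof.
apply: cvgC_ge0 (cvg_cdot (rep_seqP F) (rep_seqP F)) => n.
exact: sform_ge0.
Qed.

Definition cdot_semi : semi_inner K := SemiInner cdotP cdotC cdot_ge0.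

Lemma embed_subproof (w : E) : (s w : E -> C^o) \in completion_pred s.
Proof. by apply/asboolP; exists (fun=> w); exact: represents_cst. Qed.

Definition embed (w : E) : K := Completion (embed_subproof w).

Lemma represents_embed w : represents s (fun=> w) (embed w).
Proof. exact: represents_cst. Qed.

Lemma cdot_embed u v : cdot (embed u) (embed v) = s u v.
Proof. by apply: (cdot_unique (represents_embed u) (represents_embed v)); exact: cvg_cst. Qed.

Lemma cdot_embedr F w : cdot F (embed w) = F w.
Proof. exact: (cdot_unique (rep_seqP F) (represents_embed w) ((rep_seqP F).2 w)). Qed.

Lemma embed_linear : linear embed.
Proof.
by move=> a u v; apply: completion_ext => w /=; rewrite sformP.
Qed.

HB.instance Definition _ := GRing.isLinear.Build C E K _ embed embed_linear.

Lemma cdot_eq0 F : cdot F F = 0 -> F = 0.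
Proof.
move=> F0; apply: completion_ext => w; rewrite -cdot_embedr.
by apply: (@snorm_eq0 _ _ cdot_semi); rewrite /snorm /= F0 sqrtC0.
Qed.

Definition cnorm F : C := snorm cdot_semi F.

Lemma cnorm_triangle F G : cnorm (F + G) <= cnorm F + cnorm G.
Proof. exact: snormD. Qed.

Lemma cnormZ a F : cnorm (a *: F) = `|a| * cnorm F.
Proof. exact: snormZ. Qed.

Lemma cnorm0_eq0 F : cnorm F = 0 -> F = 0.
Proof.
move=> F0; apply: cdot_eq0.
by rewrite -[LHS](sqrtCK) -/(snorm cdot_semi F) -/(cnorm F) F0 expr0n.
Qed.

HB.instance Definition _ := Lmodule_isNormed.Build C K cnorm_triangle cnormZ cnorm0_eq0.

Lemma cnorm_embed w : `|embed w : K| = snorm s w.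
Proof. by rewrite /Num.norm /= /cnorm /snorm /= cdot_embed. Qed.

(** The distance from F to u n is the limit over k of the distance from u k to u n. *)
Lemma represents_approx u F : represents s u F ->
  forall e : C, 0 < e -> exists N, forall n, (N <= n)%N -> `|F - embed (u n)| < e.
Proof.
move=> uF e e_gt0.
have e2_gt0 : 0 < e / 2 by rewrite divr_gt0.
have [N uN] := uF.1 _ e2_gt0; exists N => n Nn.
apply: (@le_lt_trans _ _ (e / 2)); last by rewrite gtr_pMr // invf_lt1 // ltr1n.
rewrite -(@ler_pXn2r _ 2) ?nnegrE ?(ltW e2_gt0) //.
have rep : represents s (fun k => u k - u n) (F - embed (u n)).
  have := represents_linK (-1) (represents_embed (u n)) uF.
  rewrite (_ : (fun k => _) = (fun k => u k - u n)).
    by rewrite [-1 *: embed _ + F]addrC scaleN1r.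
  by apply/funext => k; rewrite scaleN1r addrC.
have cv := cvg_cdot rep rep.
rewrite (_ : `|_| ^+ 2 = cdot (F - embed (u n)) (F - embed (u n))); last exact: snormK.
rewrite -subr_ge0.
apply: (@cvgC_ge0 R (fun k => (e / 2) ^+ 2 - s (u (k + N)%N - u n) (u (k + N)%N - u n))).
  move=> k; rewrite subr_ge0 -snormK ler_pXn2r ?nnegrE ?snorm_ge0 ?(ltW e2_gt0) //.
  by rewrite ltW // uN // leq_addl.
apply: (cvgB (cvg_cst _)).
rewrite -(cvg_shiftn N) in cv.
exact: cv.
Qed.

End CompletionDot.

Section CompletionHilbert.
Variables (R : realType) (E : lmodType (cplx R)) (s : semi_inner E).
Local Notation C := (cplx R).
Local Notation K := (completion s).

(** A Cauchy filter contains balls of radius 1/(n+1) centred at elements of E; the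
    centres form a Cauchy sequence of E, whose class is the limit. *)
Lemma completion_complete (FF : set_system K) : ProperFilter FF -> cauchy FF -> cvg FF.
Proof.
move=> PF FFc; have FF_cauchy : cauchy_ex FF := (@cauchyP _ _ FF PF).1 FFc.
have eps_gt0 n : 0 < n.+1%:R^-1 :> C by rewrite invr_gt0 ltr0Sn.
have /choice [u uFF] : forall n, exists u : E, FF (ball (embed s u : K) n.+1%:R^-1).
  move=> n; have e2_gt0 : 0 < n.+1%:R^-1 / 2 :> C by rewrite divr_gt0.
  have [F FFb] := FF_cauchy _ e2_gt0.
  have [N hN] := represents_approx (rep_seqP F) e2_gt0.
  exists (rep_seq F N); apply: filterS FFb => G; rewrite -!ball_normE /= => FG.
  rewrite (splitr (n.+1%:R^-1)) -(subrK F (embed s _)) -addrA.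
  apply: le_lt_trans (ler_normD _ _) _.
  apply: ltrD; last exact: FG.
  rewrite distrC; exact: hN (leqnn N).
have u_cauchy : form_cauchy s u.
  move=> e e_gt0; have e2_gt0 : 0 < e / 2 by rewrite divr_gt0.
  have [N hN] := invS_lt_eps e2_gt0; exists N => m n Nm Nn.
  have [F []] := filter_ex (filterI (uFF m) (uFF n)).
  rewrite -!ball_normE /= => mF nF.
  rewrite -cnorm_embed linearB /= -(subrK F (embed s (u m))) -addrA [ltRHS]splitr.
  apply: le_lt_trans (ler_normD _ _) _; apply: ltrD.
    exact: lt_trans mF (hN _ Nm).
  by rewrite distrC; exact: lt_trans nF (hN _ Nn).
have [L uL] := form_cauchy_lim u_cauchy.
have L_in : L \in completion_pred s by apply/asboolP; exists u.
pose F : K := Completion L_in.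
apply/cvg_ex; exists F; apply/cvg_ballP => e e_gt0.
have e2_gt0 : 0 < e / 2 by rewrite divr_gt0.
have [N hN] := invS_lt_eps e2_gt0.
have [N' hN'] := @represents_approx R E s u F uL _ e2_gt0.
pose n := maxn N N'.
apply: filterS (uFF n) => G; rewrite -!ball_normE /= => nG.
rewrite [ltRHS]splitr -(subrK (embed s (u n)) F) -addrA.
apply: le_lt_trans (ler_normD _ _) _; apply: ltrD.
  by apply: hN'; exact: leq_maxr.
by apply: lt_trans nG (hN _ _); exact: leq_maxl.
Qed.

HB.instance Definition _ := Uniform_isComplete.Build K completion_complete.

Lemma cdot_morphl (G : K) : zmod_morphism (@cdot R E s ^~ G).
Proof. by move=> F F'; exact: (sformBl (cdot_semi s)). Qed.

Lemma cdot_morphr (F : K) : zmod_morphism (@cdot R E s F).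
Proof. by move=> G G'; exact: (sformBr (cdot_semi s)). Qed.

Lemma cdot_scall (G : K) : scalable_for *%R (@cdot R E s ^~ G).
Proof. by move=> a F; exact: (sformZl (cdot_semi s)). Qed.

Lemma cdot_scalr (F : K) : scalable_for ((@Num.conj C) \; *%R) (@cdot R E s F).
Proof. by move=> a G; exact: (sformZr (cdot_semi s)). Qed.

HB.instance Definition _ := isBilinear.Build C K K C *%R ((@Num.conj C) \; *%R)
  (@cdot R E s) cdot_morphl cdot_morphr cdot_scall cdot_scalr.

Lemma cdot_hermitian (F G : K) : cdot F G = (-1) ^+ false * (cdot G F)^*.
Proof. by rewrite expr0 mul1r -cdotC. Qed.

HB.instance Definition _ := isHermitianSesquilinear.Build C K false (@Num.conj C)
  (@cdot R E s) cdot_hermitian.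

Lemma cdot_gt0 (F : K) : F != 0 -> 0 < cdot F F.
Proof.
rewrite lt_def cdot_ge0 andbT; apply: contraNneq => F0.
exact/eqP/cdot_eq0.
Qed.

HB.instance Definition _ := isDotProduct.Build C K (@cdot R E s) cdot_gt0.

Lemma completion_dot_norm (F : K) : `|F| ^+ 2 = (@cdot R E s : {dot K for (@Num.conj C)}) F F.
Proof. exact: snormK. Qed.

Definition completion_hilbert : hilbert R := Hilbert completion_dot_norm.

End CompletionHilbert.

Theorem hilbert_completion (R : realType) (E : lmodType (cplx R)) (s : semi_inner E) :
  exists (K : hilbert R) (i : {linear E -> K}),
    (forall u v, hdot K (i u) (i v) = s u v) /\
    (forall (f : K) (e : cplx R), 0 < e -> exists u, `|f - i u| < e).
Proof.
exists (completion_hilbert s), (embed s); split=> [u v|f e e_gt0].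
  exact: cdot_embed.
have [N hN] := represents_approx (rep_seqP f) e_gt0.
by exists (rep_seq f N); exact: hN.
Qed.

(** * Total families in Hilbert spaces *)

Section HilbertTheory.
Variable R : realType.
Local Notation C := (cplx R).
Implicit Types (H K : hilbert R).

Lemma hdot_linear_subproof H (a : C) (u v w : H) :
  hdot H (a *: u + v) w = a * hdot H u w + hdot H v w.
Proof. exact: linearPl. Qed.

Lemma hdot_herm_subproof H (u v : H) : hdot H u v = (hdot H v u)^*.
Proof. by rewrite hermC expr0 mul1r. Qed.

Lemma hdot_ge0_subproof H (u : H) : 0 <= hdot H u u.
Proof. exact: dnorm_ge0. Qed.

Definition hdot_semi H : semi_inner H :=
  SemiInner (@hdot_linear_subproof H) (@hdot_herm_subproof H) (@hdot_ge0_subproof H).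

Lemma hdotC H (u v : H) : hdot H u v = (hdot H v u)^*.
Proof. exact: hdot_herm_subproof. Qed.

Lemma hdotDl H (u v w : H) : hdot H (u + v) w = hdot H u w + hdot H v w.
Proof. exact: (sformDl (hdot_semi H)). Qed.

Lemma hdotBl H (u v w : H) : hdot H (u - v) w = hdot H u w - hdot H v w.
Proof. exact: (sformBl (hdot_semi H)). Qed.

Lemma hdotZl H a (u w : H) : hdot H (a *: u) w = a * hdot H u w.
Proof. exact: (sformZl (hdot_semi H)). Qed.

Lemma hdotDr H (u v w : H) : hdot H w (u + v) = hdot H w u + hdot H w v.
Proof. exact: (sformDr (hdot_semi H)). Qed.

Lemma hdotBr H (u v w : H) : hdot H w (u - v) = hdot H w u - hdot H w v.
Proof. exact: (sformBr (hdot_semi H)). Qed.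

Lemma hdotZr H a (u w : H) : hdot H w (a *: u) = a^* * hdot H w u.
Proof. exact: (sformZr (hdot_semi H)). Qed.

Lemma hdot0l H (w : H) : hdot H 0 w = 0.
Proof. exact: (sform0l (hdot_semi H)). Qed.

Lemma hdot0r H (w : H) : hdot H w 0 = 0.
Proof. by rewrite hdotC hdot0l conjC0. Qed.

Lemma hdot_suml H (I : Type) (r : seq I) (P : pred I) (F : I -> H) w :
  hdot H (\sum_(i <- r | P i) F i) w = \sum_(i <- r | P i) hdot H (F i) w.
Proof. by elim/big_ind2: _ => [|x x' y y' <- <-|//]; rewrite ?hdot0l ?hdotDl. Qed.

Lemma hdot_sumr H (I : Type) (r : seq I) (P : pred I) (F : I -> H) w :
  hdot H w (\sum_(i <- r | P i) F i) = \sum_(i <- r | P i) hdot H w (F i).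
Proof. by elim/big_ind2: _ => [|x x' y y' <- <-|//]; rewrite ?hdot0r ?hdotDr. Qed.

Lemma hdot_eq0 H (u : H) : hdot H u u = 0 -> u = 0.
Proof. move=> u0; apply/eqP; rewrite -normr_eq0.
by have := expf_eq0 `|u| 2; rewrite hdot_norm u0 eqxx /= => <-. Qed.

Lemma hnormE H (u : H) : `|u| = snorm (hdot_semi H) u.
Proof. by rewrite /snorm /= -hdot_norm sqrCK. Qed.

Lemma hdot_CS H (u v : H) : `|hdot H u v| <= `|u| * `|v|.
Proof. by rewrite !hnormE; exact: (sform_CS (hdot_semi H)). Qed.

Definition nonexpansive H K (T : H -> K) : Prop := forall f, `|T f| <= `|f|.

Definition lincomb (X : Type) H (e : X -> H) (s : seq (C * X)) : H :=
  \sum_(u <- s) u.1 *: e u.2.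

Definition total_family (X : Type) H (e : X -> H) : Prop :=
  forall (f : H) (eps : C), 0 < eps -> exists s, `|f - lincomb e s| < eps.

Definition scale_seq (X : Type) (a : C) (s : seq (C * X)) : seq (C * X) :=
  [seq (a * u.1, u.2) | u <- s].

Lemma lincomb_cat X H (e : X -> H) s t : lincomb e (s ++ t) = lincomb e s + lincomb e t.
Proof. exact: big_cat. Qed.

Lemma lincomb_scale X H (e : X -> H) a s : lincomb e (scale_seq a s) = a *: lincomb e s.
Proof.
rewrite /lincomb big_map scaler_sumr; apply: eq_bigr => u _ /=.
by rewrite scalerA.
Qed.

Lemma lincomb1 X H (e : X -> H) x : lincomb e [:: (1, x)] = e x.
Proof. by rewrite /lincomb big_seq1 scale1r. Qed.

Lemma linear_lincomb X H K (e : X -> H) (T : {linear H -> K}) s :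
  T (lincomb e s) = lincomb (fun x => T (e x)) s.
Proof. by rewrite linear_sum; apply: eq_bigr => u _; rewrite linearZ. Qed.

Lemma lincomb_norm2 X H (e : X -> H) s :
  `|lincomb e s| ^+ 2 = gram_form (fun x y => hdot H (e x) (e y)) s.
Proof.
rewrite hdot_norm hdot_suml; apply: eq_bigr => u _.
rewrite hdot_sumr; apply: eq_bigr => v _.
by rewrite hdotZl hdotZr mulrA.
Qed.

Lemma gram_formB X (G G' : X -> X -> C) s :
  gram_form (fun x y => G x y - G' x y) s = gram_form G s - gram_form G' s.
Proof.
rewrite -sumrB; apply: eq_bigr => u _; rewrite -sumrB; apply: eq_bigr => v _.
by rewrite mulrBr.
Qed.

Lemma lincomb_dominated X H K (e : X -> H) (g : X -> K) s :
  psd (fun x y => hdot H (e x) (e y) - hdot K (g x) (g y)) ->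
  `|lincomb g s| <= `|lincomb e s|.
Proof.
move=> /(_ s); rewrite gram_formB subr_ge0 -!lincomb_norm2.
by rewrite ler_pXn2r ?nnegrE.
Qed.

Lemma hilbert_cauchy_cvg K (v : nat -> K) :
  (forall e : C, 0 < e ->
     exists N, forall m n, (N <= m)%N -> (N <= n)%N -> `|v m - v n| < e) ->
  exists h, forall e : C, 0 < e -> exists N, forall n, (N <= n)%N -> `|h - v n| < e.
Proof.
move=> v_cauchy.
have /cvg_ex [h vh] : cvgn v.
  apply/cauchy_cvgP; apply: cauchy_exP => e /v_cauchy [N hN].
  exists (v N); exists N => // n /= Nn; rewrite -ball_normE /=.
  exact: hN (leqnn N) Nn.
exists h => e e_gt0.
have [N _ hN] := (cvgrPdist_lt _ _).1 vh e e_gt0.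
by exists N => n Nn; exact: hN.
Qed.

Lemma cauchy_inv_cvg K (v : nat -> K) :
  (forall m n, `|v m - v n| <= m.+1%:R^-1 + n.+1%:R^-1) ->
  exists h, forall e : C, 0 < e -> exists N, forall n, (N <= n)%N -> `|h - v n| < e.
Proof.
move=> v_cauchy; apply: hilbert_cauchy_cvg => e e_gt0.
have e2_gt0 : 0 < e / 2 by rewrite divr_gt0.
have [N hN] := invS_lt_eps e2_gt0; exists N => m n Nm Nn.
apply: le_lt_trans (v_cauchy _ _) _; rewrite [ltRHS]splitr.
by apply: ltrD; apply: hN.
Qed.

(** The image h of f is characterised by |h - sum c_i g_i| <= |f - sum c_i e_i| for
    all finite combinations. Totality makes h unique and shows that h depends
    linearly on f; h exists as the limit of the images of combinations that tend to
    f. *)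
Lemma nonexpansive_extension X H K (e : X -> H) (g : X -> K) :
  total_family e -> psd (fun x y => hdot H (e x) (e y) - hdot K (g x) (g y)) ->
  exists T : {linear H -> K},
    (forall x, T (e x) = g x) /\ nonexpansive T.
Proof.
move=> e_total dom.
have le_dom s := lincomb_dominated s dom.
pose ext f h := forall s, `|h - lincomb g s| <= `|f - lincomb e s|.
have ext_ex f : exists h, ext f h.
  have inv_gt0 n : 0 < n.+1%:R^-1 :> C by rewrite invr_gt0 ltr0Sn.
  have [s hs] := choice (fun n => e_total f _ (inv_gt0 n)).
  have subE t t' : lincomb g t - lincomb g t' = lincomb g (t ++ scale_seq (-1) t').
    by rewrite lincomb_cat lincomb_scale scaleN1r.
  have subEe t t' : lincomb e t - lincomb e t' = lincomb e (t ++ scale_seq (-1) t').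
    by rewrite lincomb_cat lincomb_scale scaleN1r.
  have [|h hh] := @cauchy_inv_cvg K (fun n => lincomb g (s n)).
    move=> m n; rewrite subE; apply: le_trans (le_dom _) _; rewrite -subEe.
    rewrite -(subrK f (lincomb e (s m))) -addrA.
    apply: le_trans (ler_normD _ _) _; apply: lerD; last exact/ltW/hs.
    by rewrite distrC; exact/ltW/hs.
  exists h => t; apply/ler_addgt0Pr => eps eps_gt0.
  have e2_gt0 : 0 < eps / 2 by rewrite divr_gt0.
  have [N hN] := hh _ e2_gt0; have [N' hN'] := invS_lt_eps e2_gt0.
  pose n := maxn N N'.
  rewrite -(subrK (lincomb g (s n)) h) -addrA.
  apply: le_trans (ler_normD _ _) _; rewrite subE.
  apply: (@le_trans _ _ (eps / 2 + (eps / 2 + `|f - lincomb e t|))); last first.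
    by rewrite addrA -splitr addrC.
  apply: lerD; first by apply/ltW/hN; exact: leq_maxl.
  apply: le_trans (le_dom _) _; rewrite -subEe.
  rewrite -(subrK f (lincomb e (s n))) -addrA.
  apply: le_trans (ler_normD _ _) _; apply: lerD; last exact: lexx.
  by rewrite distrC; apply/ltW/(lt_trans (hs n))/hN'; exact: leq_maxr.
have ext_uniq f h h' : ext f h -> ext f h' -> h = h'.
  move=> fh fh'; apply/eqP; rewrite -subr_eq0 -normr_le0.
  apply/ler_addgt0Pr => eps eps_gt0; rewrite add0r.
  have e2_gt0 : 0 < eps / 2 by rewrite divr_gt0.
  have [s hs] := e_total f _ e2_gt0.
  rewrite -(subrK (lincomb g s) h) -addrA [leRHS]splitr.
  apply: le_trans (ler_normD _ _) _; apply: lerD.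
    exact: le_trans (fh s) (ltW hs).
  by rewrite distrC; exact: le_trans (fh' s) (ltW hs).
have regroup (V : zmodType) (x y p q r : V) :
    x + y - r = (x - p) + (y - q) + (p + (q - r)).
  by rewrite addrACA subrK [y - q + _]addrA subrK addrA.
have ext_lin a f h f' h' : ext f h -> ext f' h' -> ext (a *: f + f') (a *: h + h').
  move=> fh fh' s; apply/ler_addgt0Pr => eps eps_gt0.
  have e4_gt0 : 0 < eps / 2 / 2 by rewrite !divr_gt0.
  have a1_gt0 : 0 < `|a| + 1 by rewrite ltr_wpDl.
  have [t ht] := e_total f _ (divr_gt0 e4_gt0 a1_gt0).
  have [t' ht'] := e_total f' _ e4_gt0.
  have at_le : `|a| * `|f - lincomb e t| <= eps / 2 / 2.
    apply: (@le_trans _ _ ((`|a| + 1) * `|f - lincomb e t|)).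
      by rewrite ler_wpM2r // lerDl.
    by rewrite mulrC -ler_pdivlMr // ltW.
  pose r := scale_seq a t ++ t' ++ scale_seq (-1) s.
  have split_g : a *: h + h' - lincomb g s =
      a *: (h - lincomb g t) + (h' - lincomb g t') + lincomb g r.
    rewrite /r !lincomb_cat !lincomb_scale scaleN1r scalerBr.
    exact: regroup.
  have split_e : lincomb e r = (a *: f + f' - lincomb e s)
      - (a *: (f - lincomb e t) + (f' - lincomb e t')).
    rewrite /r !lincomb_cat !lincomb_scale scaleN1r scalerBr.
    by apply/eqP; rewrite eq_sym subr_eq [eqbRHS]addrC; apply/eqP; exact: regroup.
  have small h0 h1 : `|h0| <= `|f - lincomb e t| -> `|h1| <= `|f' - lincomb e t'| ->
      `|a| * `|h0| + `|h1| <= eps / 2.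
    move=> le0 le1; rewrite [leRHS]splitr; apply: lerD.
      apply: le_trans at_le; exact: ler_wpM2l.
    exact: le_trans le1 (ltW ht').
  have small_f : `|a *: (f - lincomb e t) + (f' - lincomb e t')| <= eps / 2.
    apply: le_trans (ler_normD _ _) _; rewrite normrZ [leRHS]splitr.
    by apply: lerD => //; exact: ltW.
  have small_h : `|a *: (h - lincomb g t) + (h' - lincomb g t')| <= eps / 2.
    apply: le_trans (ler_normD _ _) _; rewrite normrZ [leRHS]splitr.
    apply: lerD; last exact: le_trans (fh' _) (ltW ht').
    apply: le_trans at_le; apply: ler_wpM2l; [exact: normr_ge0|exact: fh].
  rewrite split_g; apply: le_trans (ler_normD _ _) _.
  rewrite [X in _ <= _ + X]splitr [leRHS]addrCA; apply: lerD; first exact: small_h.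
  apply: le_trans (le_dom _) _; rewrite split_e.
  apply: le_trans (ler_normB _ _) _.
  by apply: lerD; [exact: lexx|exact: small_f].
have [T hT] := choice ext_ex.
have T_lin : linear T.
  by move=> a f f'; apply: (ext_uniq (a *: f + f')); [exact: hT|exact: ext_lin].
pose Tl := GRing.isLinear.Build C H K *:%R T T_lin.
pose TL : {linear H -> K} := HB.pack T Tl.
exists TL; split=> [x|f].
  apply: (ext_uniq (e x)); first exact: hT.
  move=> s.
  have subE (L : hilbert R) (b : X -> L) : b x - lincomb b s =
      lincomb b ([:: (1, x)] ++ scale_seq (-1) s).
    by rewrite lincomb_cat lincomb1 lincomb_scale scaleN1r.
  by rewrite !subE.
by have := hT f [::]; rewrite /lincomb !big_nil !subr0.
Qed.

End HilbertTheory.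

Section Density.
Variable R : realType.
Local Notation C := (cplx R).
Implicit Types (H K L : hilbert R).

(** The difference of the two sides is a bounded functional of f that vanishes on
    the span of e, which is dense. *)
Lemma total_hdot X H K L (e : X -> H)
    (A : {linear H -> K}) (B : {linear H -> L}) (w : K) (w' : L) :
  total_family e -> nonexpansive A -> nonexpansive B ->
  (forall x, hdot K (A (e x)) w = hdot L (B (e x)) w') ->
  forall f, hdot K (A f) w = hdot L (B f) w'.
Proof.
move=> e_total Ac Bc AB f; apply/eqP; rewrite -subr_eq0 -normr_le0.
apply/ler_addgt0Pr => eps eps_gt0; rewrite add0r.
have M_gt0 : 0 < `|w| + `|w'| + 1 by rewrite ltr_wpDl ?addr_ge0.
have [s hs] := e_total f _ (divr_gt0 eps_gt0 M_gt0).
have AB_s : hdot K (A (lincomb e s)) w = hdot L (B (lincomb e s)) w'.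
  rewrite !linear_lincomb !hdot_suml; apply: eq_bigr => u _.
  by rewrite !hdotZl AB.
have -> : hdot K (A f) w - hdot L (B f) w' =
    hdot K (A (f - lincomb e s)) w - hdot L (B (f - lincomb e s)) w'.
  by rewrite !linearB !hdotBl AB_s opprB addrA subrK.
apply: (@le_trans _ _ (`|f - lincomb e s| * (`|w| + `|w'| + 1))); last first.
  by rewrite -ler_pdivlMr // ltW.
apply: le_trans (ler_normB _ _) _.
apply: (@le_trans _ _ (`|f - lincomb e s| * `|w| + `|f - lincomb e s| * `|w'|)).
  apply: lerD; apply: le_trans (hdot_CS _ _) _; apply: ler_wpM2r.
  - exact: normr_ge0.
  - exact: Ac.
  - exact: normr_ge0.
  - exact: Bc.
by rewrite -mulrDr; apply: ler_wpM2l; [exact: normr_ge0|rewrite lerDl].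
Qed.

Lemma total_ext X H K (e : X -> H) (A B : {linear H -> K}) :
  total_family e -> nonexpansive A -> nonexpansive B ->
  (forall x, A (e x) = B (e x)) -> forall f, A f = B f.
Proof.
move=> e_total Ac Bc AB f; apply/eqP; rewrite -subr_eq0; apply/eqP/hdot_eq0.
rewrite hdotBl; apply/eqP; rewrite subr_eq0; apply/eqP.
by apply: (total_hdot e_total) => // x; rewrite AB.
Qed.

Lemma total_hdot2 X (Y : Type) H (H' : hilbert R) K L (e : X -> H) (e' : Y -> H')
    (A : {linear H -> K}) (B : {linear H -> L})
    (A' : {linear H' -> K}) (B' : {linear H' -> L}) :
  total_family e -> total_family e' ->
  nonexpansive A -> nonexpansive B -> nonexpansive A' -> nonexpansive B' ->
  (forall x y, hdot K (A (e x)) (A' (e' y)) = hdot L (B (e x)) (B' (e' y))) ->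
  forall f g, hdot K (A f) (A' g) = hdot L (B f) (B' g).
Proof.
move=> e_total e'_total Ac Bc A'c B'c AB f g.
rewrite hdotC [RHS]hdotC; congr (_^*).
apply: (total_hdot e'_total) => // y.
rewrite hdotC [RHS]hdotC; congr (_^*).
exact: (total_hdot e_total).
Qed.

End Density.

Section Kolmogorov.
Variables (R : realType) (X : choiceType) (G : X -> X -> cplx R).
Local Notation C := (cplx R).
Local Notation E := {freeg X / C}.

Hypothesis G_psd : psd G.
Hypothesis G_herm : forall x y, G x y = (G y x)^*.

Lemma fgliftB (f : X -> C^o) (u v : E) : fglift f (u - v) = fglift f u - fglift f v.
Proof. exact: lift_is_additive. Qed.

Lemma fglift0 (f : X -> C^o) : fglift f (0 : E) = 0.
Proof. by have := fgliftB f 0 0; rewrite !subrr. Qed.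

Lemma fgliftD (f : X -> C^o) (u v : E) : fglift f (u + v) = fglift f u + fglift f v.
Proof.
have N : fglift f (- v) = - fglift f v by rewrite -sub0r fgliftB fglift0 sub0r.
by rewrite -[v in LHS]opprK fgliftB N opprK.
Qed.

Lemma fglift_sum (f : X -> C^o) (I : Type) (r : seq I) (F : I -> E) :
  fglift f (\sum_(i <- r) F i) = \sum_(i <- r) fglift f (F i).
Proof. by elim/big_ind2: _ => [|x x' y y' <- <-|//]; rewrite ?fglift0 ?fgliftD. Qed.

Lemma fglift_lin (f : X -> C^o) (a : C) (u v : E) :
  fglift f (a *: u + v) = a * fglift f u + fglift f v.
Proof.
rewrite fgliftD; congr (_ + _).
rewrite -[u in RHS]freeg_sumE fglift_sum mulr_sumr [LHS]fglift_sum.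
by apply: eq_bigr => z _; rewrite !liftU; exact: esym (mulrA _ _ _).
Qed.

(** The form with Gram matrix G on the free vector space over X, written so that
    linearity in u is that of the universal property. *)
Definition free_form (u v : E) : C :=
  fglift (fun x => (fglift (fun y => G y x : C^o) v)^* : C^o) u.

Lemma fglift_enum (f : X -> C^o) (u : E) : fglift f u = \sum_(z <- fgenum u) z.1 * f z.2.
Proof. by rewrite -{1}[u]Freeg_enum fglift_Freeg. Qed.

Lemma free_formE (u v : E) :
  free_form u v = \sum_(a <- fgenum u) \sum_(b <- fgenum v) a.1 * b.1^* * G a.2 b.2.
Proof.
rewrite /free_form fglift_enum; apply: eq_bigr => a _.
rewrite fglift_enum rmorph_sum mulr_sumr; apply: eq_bigr => b _.
by rewrite rmorphM /= -G_herm mulrA.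
Qed.

Lemma free_formP (a : C) (u v w : E) :
  free_form (a *: u + v) w = a * free_form u w + free_form v w.
Proof. exact: fglift_lin. Qed.

Lemma free_formC (u v : E) : free_form u v = (free_form v u)^*.
Proof.
rewrite !free_formE exchange_big rmorph_sum /=; apply: eq_bigr => a _.
rewrite rmorph_sum; apply: eq_bigr => b _ /=.
by rewrite !rmorphM /= conjCK -G_herm [a.1^* * _]mulrC.
Qed.

Lemma free_form_ge0 (u : E) : 0 <= free_form u u.
Proof. by rewrite free_formE; exact: G_psd. Qed.

(** Kolmogorov decomposition: complete the free vector space over X for the form
    with Gram matrix G. *)
Theorem kernel_realization : exists (K : hilbert R) (g : X -> K),
  (forall x y, hdot K (g x) (g y) = G x y) /\ total_family g.
Proof.
have [K [i [i_dot i_dense]]] :=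
  hilbert_completion (SemiInner free_formP free_formC free_form_ge0).
have i_enum (u : E) : i u = lincomb (fun x => i << x >>) (fgenum u).
  rewrite -[LHS]/(i u) -{1}[u]Freeg_enum.
  elim: (fgenum u) => [|[c x] r IHr]; first by rewrite /lincomb big_nil freeg_nil linear0.
  rewrite -cat1s freeg_cat linearD IHr lincomb_cat; congr (_ + _).
  rewrite /lincomb big_seq1 -linearZ /=; congr (i _).
  by apply/eqP/freeg_eqP => y; rewrite coeffZ !coeffU mul1r.
exists K, (fun x => i << x >>); split=> [x y|f e e_gt0].
  by rewrite i_dot /= /free_form !liftU !scale1r -G_herm.
by have [u fu] := i_dense f e e_gt0; exists (fgenum u); rewrite -i_enum.
Qed.

End Kolmogorov.

(** * Orthogonal families *)

Section Orthogonal.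
Variables (R : realType) (H : hilbert R) (e : nat -> H) (b : nat -> R).
Local Notation C := (cplx R).
Hypothesis b_gt0 : forall k, 0 < b k.
Hypothesis e_orth : forall k l, hdot H (e k) (e l) = if k == l then toC (b k)^-1 else 0.

Lemma cvg_hdotl (v : nat -> H) (h f : H) :
  (forall eps : C, 0 < eps -> exists N, forall n, (N <= n)%N -> `|h - v n| < eps) ->
  (fun n => hdot H (v n) f) @ \oo --> hdot H h f.
Proof.
move=> vh; apply: cvgC_of_dist => eps eps_gt0.
have M_gt0 : 0 < `|f| + 1 by rewrite ltr_wpDl.
have [N hN] := vh _ (divr_gt0 eps_gt0 M_gt0); exists N => n Nn.
rewrite -hdotBl; apply: le_lt_trans (hdot_CS _ _) _.
apply: (@le_lt_trans _ _ (`|h - v n| * (`|f| + 1))).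
  by apply: ler_wpM2l; [exact: normr_ge0|rewrite lerDl].
by rewrite -ltr_pdivlMr //; exact: hN.
Qed.

Definition coef_sum (c : nat -> C) n : H := \sum_(k < n) c k *: e k.

Lemma hdot_coef_sum_e (c : nat -> C) n k : (k < n)%N ->
  hdot H (coef_sum c n) (e k) = c k / toC (b k).
Proof.
move=> k_n; rewrite hdot_suml (bigD1 (Ordinal k_n)) //= big1 ?addr0.
  by rewrite hdotZl e_orth eqxx fmorphV.
by move=> i /negbTE ik; rewrite hdotZl e_orth (_ : (i == k :> nat) = false) ?mulr0.
Qed.

Lemma hdot_coef_sum (c : nat -> C) n f :
  (forall k, (k < n)%N -> hdot H f (e k) = c k / toC (b k)) ->
  hdot H f (coef_sum c n) = \sum_(k < n) `|c k| ^+ 2 / toC (b k).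
Proof.
move=> fe; rewrite hdot_sumr; apply: eq_bigr => k _.
by rewrite hdotZr fe // normCK mulrA [_^* * _]mulrC.
Qed.

Lemma coef_sum_norm2 (c : nat -> C) n :
  `|coef_sum c n| ^+ 2 = \sum_(k < n) `|c k| ^+ 2 / toC (b k).
Proof. by rewrite hdot_norm; apply: hdot_coef_sum => k; exact: hdot_coef_sum_e. Qed.

Lemma coef_sumB_norm2 (c : nat -> C) m n : (m <= n)%N ->
  `|coef_sum c n - coef_sum c m| ^+ 2 = `|coef_sum c n| ^+ 2 - `|coef_sum c m| ^+ 2.
Proof.
move=> m_n; rewrite [LHS]hdot_norm hdotBl !hdotBr.
have nm : hdot H (coef_sum c n) (coef_sum c m) = `|coef_sum c m| ^+ 2.
  rewrite coef_sum_norm2; apply: hdot_coef_sum => k k_m; apply: hdot_coef_sum_e.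
  exact: leq_trans k_m m_n.
rewrite (hdotC (coef_sum c m)) nm -!hdot_norm.
have /CrealP -> : `|coef_sum c m| ^+ 2 \is Num.real by rewrite ger0_real.
by ring.
Qed.

Lemma coef_sum_dist2 (c : nat -> C) n f :
  (forall k, (k < n)%N -> hdot H f (e k) = c k / toC (b k)) ->
  `|f - coef_sum c n| ^+ 2 = `|f| ^+ 2 - `|coef_sum c n| ^+ 2.
Proof.
move=> fe; rewrite [LHS]hdot_norm hdotBl !hdotBr.
have fn : hdot H f (coef_sum c n) = `|coef_sum c n| ^+ 2.
  by rewrite hdot_coef_sum // coef_sum_norm2.
rewrite (hdotC (coef_sum c n) f) fn -!hdot_norm.
have /CrealP -> : `|coef_sum c n| ^+ 2 \is Num.real by rewrite ger0_real.
by ring.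
Qed.

(** Bessel's inequality makes the orthogonal expansion of f converge; the limit and
    f have the same coefficients, so they agree. *)
Lemma total_orthogonal :
  (forall f, (forall k, hdot H f (e k) = 0) -> f = 0) -> total_family e.
Proof.
move=> e_sep f.
(* the coefficients of f: e k has squared norm 1 / b k *)
pose c k := hdot H f (e k) * toC (b k).
have b0 k : toC (b k) != 0 by rewrite fmorph_eq0 gt_eqF.
have fe k : hdot H f (e k) = c k / toC (b k) by rewrite /c mulfK.
pose S n : R := complex.Re (`|coef_sum c n| ^+ 2).
have SE n : `|coef_sum c n| ^+ 2 = toC (S n) by apply: ge0_toC; rewrite exprn_ge0.
have S_mono : {homo S : m n / (m <= n)%N >-> m <= n}.
  by move=> m n m_n; rewrite -ler_toC -!SE -subr_ge0 -coef_sumB_norm2 // exprn_ge0.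
have S_cvg : cvgn S.
  apply: nondecreasing_is_cvgn => //.
  exists (complex.Re (`|f| ^+ 2)) => _ [n _ <-].
  rewrite -ler_toC -SE -ge0_toC ?exprn_ge0 // -subr_ge0 -coef_sum_dist2 // exprn_ge0 //.
have [|g cg] := @hilbert_cauchy_cvg R H (coef_sum c).
  move=> eps eps_gt0.
  have e2_gt0 : 0 < eps ^+ 2 by rewrite exprn_gt0.
  have [L SL] := (cvg_ex _).1 S_cvg.
  have [|N hN] := cvgC_dist (cvgC_real SL) (e := eps ^+ 2 / 2).
    by rewrite divr_gt0.
  exists N => m n; wlog mn : m n / (m <= n)%N.
    move=> wl Nm Nn; have [/wl|/ltnW/wl] := leqP m n; first exact.
    by rewrite distrC; exact.
  move=> Nm Nn.
  rewrite distrC -(@ltr_pXn2r _ 2) ?nnegrE ?normr_ge0 ?(ltW eps_gt0) //.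
  rewrite coef_sumB_norm2 // !SE.
  have -> : toC (S n) - toC (S m) = (toC L - toC (S m)) - (toC L - toC (S n)) by ring.
  rewrite -[X in X < _]ger0_norm; last first.
    rewrite (_ : _ - _ - _ = toC (S n) - toC (S m)); last by ring.
    by rewrite subr_ge0 ler_toC S_mono.
  apply: le_lt_trans (ler_normB _ _) _; rewrite [ltRHS]splitr.
  by apply: ltrD; exact: hN.
have -> : f = g.
  apply/eqP; rewrite -subr_eq0; apply/eqP/e_sep => k; rewrite hdotBl.
  apply/eqP; rewrite subr_eq0; apply/eqP.
  have := cvg_hdotl (f := e k) cg; rewrite -(cvg_shiftn k.+1) => cgk.
  apply: cvgC_unique cgk.
  rewrite (_ : (fun n => _) = fun=> hdot H f (e k)); first exact: cvg_cst.
  by apply/funext => n; rewrite hdot_coef_sum_e ?fe // addnS ltnS leq_addl.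
move=> eps /cg [N hN]; exists [seq (c k, k) | k <- iota 0 N].
rewrite (_ : lincomb _ _ = coef_sum c N); first exact: hN.
by rewrite /lincomb big_map -[N in iota 0 N]subn0 big_mkord.
Qed.

End Orthogonal.

(** * Monomials in a reproducing kernel space *)

Section Monomials.
Variables (R : realType) (K : cplx R -> cplx R -> cplx R) (b : nat -> R).
Variables (H : hilbert R) (ev : H -> cplx R -> cplx R).
Local Notation C := (cplx R).
Hypothesis b_gt0 : forall k, 0 < b k.
Hypothesis K_exp : has_expansion b K.
Hypothesis H_rkhs : is_rkhs K ev.

Let half : C := toC 2^-1.

Lemma toC_disc (t : R) : 0 <= t < 1 -> toC t \in disc R.
Proof. by move=> /andP[t0 t1]; rewrite inE /disc /= normC_toC ltr_toC ger0_norm. Qed.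

Let half_disc : half \in disc R.
Proof. by apply: toC_disc; rewrite invr_ge0 ler0n invf_lt1 // ltr1n. Qed.

Lemma half_series_le N : \sum_(0 <= l < N) toC (b l * 4^-1 ^+ l) <= K half half.
Proof.
rewrite -subr_ge0; have := K_exp half_disc half_disc.
rewrite -(cvg_shiftn N) => h.
apply: (@cvgC_ge0 R (fun n => series (fun k => (real_complex R (b k) : C) *
   (half * half^*) ^+ k) (n + N)%N - \sum_(0 <= l < N) toC (b l * 4^-1 ^+ l))).
  move=> n; rewrite /series /= (big_cat_nat (n := N)) ?leq_addl //=.
  rewrite [X in X + _ - _](_ : _ = \sum_(0 <= l < N) toC (b l * 4^-1 ^+ l)).
    rewrite addrC addKr sumr_ge0 // => l _.
    by rewrite conj_toC -rmorphM -rmorphXn -[real_complex R (b l)]/(toC (b l)) -rmorphM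
       toC_ge0 mulr_ge0 ?ltW // exprn_ge0 ?mulr_ge0 ?invr_ge0.
  apply: eq_bigr => l _; rewrite conj_toC -rmorphM -rmorphXn.
  rewrite -[real_complex R (b l)]/(toC (b l)) -rmorphM.
  by congr (toC (_ * _ ^+ _)); rewrite -invfM -natrM.
exact: (cvgB h (cvg_cst _)).
Qed.

(** Compare termwise with the series at 1/4 = (1/2)(1/2), whose sum is K (1/2)
    (1/2). *)
Lemma kernel_tail (z w : C) k : z \in disc R -> w \in disc R ->
  `|z * w^*| <= toC 4^-1 ->
  `|K z w - \sum_(l < k) toC (b l) * (z * w^*) ^+ l| <=
    `|z * w^*| ^+ k * toC (4 ^+ k : R) * K half half.
Proof.
move=> zD wD zw_le; set x := z * w^*.
have x_le : `|x| <= toC 4^-1 by [].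
apply: (@cvgC_norm_le R (fun n => series (fun k => (real_complex R (b k) : C) * x ^+ k) n
    - \sum_(l < k) toC (b l) * x ^+ l) _ _ k).
  exact: (cvgB (K_exp zD wD) (cvg_cst _)).
move=> n k_n; rewrite /series /= (big_cat_nat (n := k)) //= big_mkord addrC.
rewrite addrK.
apply: le_trans (ler_norm_sum _ _ _) _.
apply: (@le_trans _ _ (\sum_(k <= l < n) `|x| ^+ k * toC (4 ^+ k : R) * toC (b l * 4^-1 ^+ l))).
  rewrite big_nat [leRHS]big_nat; apply: ler_sum => l /andP[k_l _].
  have pow_le : `|x| ^+ l <= `|x| ^+ k * (toC (4 ^+ k : R) * toC (4^-1 ^+ l)).
    have -> : toC (4 ^+ k : R) * toC (4^-1 ^+ l) = toC 4^-1 ^+ (l - k).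
       rewrite -toCM -toCX -{1}(subnK k_l) exprD mulrCA -exprMn.
      by rewrite mulfV ?pnatr_eq0 // expr1n mulr1.
    rewrite -{1}(subnK k_l) exprD mulrC; apply: ler_wpM2l; first by rewrite exprn_ge0.
    apply: lerXn2r => //.
    by rewrite nnegrE toC_ge0 invr_ge0 ler0n.
  rewrite normrM normrX -[real_complex R (b l)]/(toC (b l)) normC_toC (ger0_norm (ltW (b_gt0 l))).
  rewrite toCM mulrCA -[X in _ <= _ * X]mulrA; apply: ler_wpM2l => //.
  by rewrite toC_ge0 ltW.
rewrite -mulr_sumr; apply: ler_wpM2l.
  by apply: mulr_ge0; [exact/exprn_ge0/normr_ge0|rewrite toC_ge0 exprn_ge0].

apply: le_trans (half_series_le n); rewrite [leRHS](big_cat_nat (n := k)) //= lerDr.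
apply: sumr_ge0 => l _; rewrite toC_ge0 mulr_ge0 ?ltW // exprn_ge0 // invr_ge0 //.
Qed.

Lemma rkhs_kernel_ex : exists kernel_at : C -> H, forall w, w \in disc R ->
  (forall z, z \in disc R -> ev (kernel_at w) z = K z w) /\
  (forall f : H, hdot H f (kernel_at w) = ev f w).
Proof.
have [_ _ _ ker] := H_rkhs.
have /choice [kernel_at hkw] : forall w, exists k_w : H, w \in disc R ->
    (forall z, z \in disc R -> ev k_w z = K z w) /\ (forall f : H, hdot H f k_w = ev f w).
  move=> w; have [wD|wD] := boolP (w \in disc R); last by exists 0.
  by have [k hk] := ker w wD; exists k.
by exists kernel_at.
Qed.

Definition kernel_at : C -> H := sval (cid rkhs_kernel_ex).

Lemma ev_kernel_at w z : w \in disc R -> z \in disc R -> ev (kernel_at w) z = K z w.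
Proof. by move=> wD; exact: (svalP (cid rkhs_kernel_ex) w wD).1. Qed.

Lemma hdot_kernel_at w f : w \in disc R -> hdot H f (kernel_at w) = ev f w.
Proof. by move=> wD; exact: (svalP (cid rkhs_kernel_ex) w wD).2. Qed.

Lemma ev_inj (f g : H) : (forall z, z \in disc R -> ev f z = ev g z) -> f = g.
Proof. by case: H_rkhs => _ h _ _; exact: h. Qed.

Definition monomial_at (k : nat) (e : H) : Prop :=
  forall z, z \in disc R -> ev e z = z ^+ k.

(** Orthogonality is required against every vector that evaluates to z^l, so that
    the induction can be run without naming the lower monomials. *)
Definition monomial_spec (k : nat) (e : H) : Prop :=
  [/\ monomial_at k e, hdot H e e = toC (b k)^-1 &
    forall l e', (l < k)%N -> monomial_at l e' -> hdot H e' e = 0].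

Let B0 k : toC (b k) != 0.
Proof. by rewrite fmorph_eq0 gt_eqF. Qed.

(** With t real and small, deprive the kernel function at t of its first k terms and
    divide by b_k t^k: the value at z is z^k + O(t). The inner product of two such
    vectors is 1 / b_k + O(t t'), so they form a Cauchy family; its limit is z^k. *)
Lemma monomial_step k : (forall l, (l < k)%N -> exists e, monomial_spec l e) ->
  exists e, monomial_spec k e.
Proof.
move=> IH.
have /choice [E hE] : forall l, exists e, (l < k)%N -> monomial_spec l e.
  move=> l; have [lk|kl] := ltnP l k; last by exists 0.
  by have [e he] := IH l lk; exists e.
have E_at l : (l < k)%N -> monomial_at l (E l) by move=> /hE [].
have E_orth l l' : (l < k)%N -> (l' < k)%N ->
    hdot H (E l) (E l') = if l == l' then toC (b l)^-1 else 0.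
  move=> lk l'k; have [ll'|l'l|ll'] := ltngtP l l'.
  - by have [_ _ h] := hE l' l'k; apply: (h l) => //; exact: E_at.
  - by have [_ _ h] := hE l lk; rewrite hdotC (h l') ?conjC0 //; exact: E_at.
  - by rewrite -ll'; have [_ ->] := hE l lk.
pose M : C := toC (4 ^+ k.+1 : R) * K half half / toC (b k) ^+ 2.
have K_ge0 : 0 <= K half half by have := half_series_le 0; rewrite big_geq.
have M_ge0 : 0 <= M.
  apply: divr_ge0; last by rewrite exprn_ge0 // toC_ge0 ltW.
  by apply: mulr_ge0 => //; rewrite toC_ge0 exprn_ge0.
pose rM : R := complex.Re M.
have ME : M = toC rM by exact: ge0_toC.
have rM_ge0 : 0 <= rM by rewrite -toC_ge0 -ME.
(* S^2 >= M makes the vectors Cauchy at rate 1/(n+1), and S >= 4 keeps t n <= 1/4 *)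
pose S : R := 4 + rM.
have S_gt0 : 0 < S by rewrite ltr_pwDl.
pose t n : R := (n.+1%:R * S)^-1.
have t_gt0 n : 0 < t n by rewrite invr_gt0 mulr_gt0.
have t_inv n : t n <= n.+1%:R^-1 / 4.
  by rewrite /t invfM ler_wpM2l ?invr_ge0 // lef_pV2 ?posrE // lerDl.
have t_le n : t n <= 4^-1.
  apply: le_trans (t_inv n) _; by rewrite ler_piMl ?invr_ge0 // invf_le1 // ler1n.
have t_disc n : toC (t n) \in disc R.
  apply: toC_disc; rewrite ltW //=; apply: le_lt_trans (t_le n) _.
  by rewrite invf_lt1 // ltr1n.
pose res n : H := kernel_at (toC (t n)) - \sum_(l < k) toC (b l * t n ^+ l) *: E l.
pose g n : H := toC (b k * t n ^+ k)^-1 *: res n.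
have den0 n : toC (b k * t n ^+ k) != 0.
  by rewrite fmorph_eq0 mulf_neq0 ?expf_neq0 ?gt_eqF.
have dot_res f n : hdot H f (res n) =
    ev f (toC (t n)) - \sum_(l < k) toC (b l * t n ^+ l) * hdot H f (E l).
  rewrite hdotBr hdot_kernel_at // hdot_sumr; congr (_ - _).
  by apply: eq_bigr => l _; rewrite hdotZr conj_toC.
have dot_E_res l n : (l < k)%N -> hdot H (E l) (res n) = 0.
  move=> lk; rewrite dot_res E_at // (bigD1 (Ordinal lk)) //= big1 ?addr0.
    by rewrite E_orth // eqxx -toCM mulrAC mulfV ?gt_eqF // mul1r toCX subrr.
  move=> i il; rewrite E_orth // ifN ?mulr0 //.
  by rewrite eq_sym.
have dot_g f n : hdot H f (g n) = hdot H f (res n) / toC (b k * t n ^+ k).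
  by rewrite hdotZr conj_toC mulrC fmorphV.
have ev_res n z : z \in disc R -> ev (res n) z =
    K z (toC (t n)) - \sum_(l < k) toC (b l) * (z * (toC (t n))^*) ^+ l.
  move=> zD; rewrite -hdot_kernel_at // hdotBl hdot_kernel_at // ev_kernel_at //.
  rewrite hdot_suml; congr (_ - _).
  apply: eq_bigr => l _; rewrite hdotZl hdot_kernel_at // E_at // toCM toCX conj_toC.
  by rewrite exprMn [z ^+ l * _]mulrC mulrA.
have ev_g n z : z \in disc R -> ev (g n) z = ev (res n) z / toC (b k * t n ^+ k).
  by move=> zD; rewrite -hdot_kernel_at // hdotZl hdot_kernel_at // mulrC fmorphV.
(* the factor |z|^(k+1), used at z = t n, gives the next estimate its factor t n *)
have ev_g_close n z : z \in disc R ->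
    `|ev (g n) z - z ^+ k| <= `|z| ^+ k.+1 * toC (t n) * (M * toC (b k)).
  move=> zD; have z_le1 : `|z| <= 1 by apply: ltW; move: zD; rewrite inE.
  have zt : `|z * (toC (t n))^*| = `|z| * toC (t n).
    by rewrite normrM conj_toC normC_toC (ger0_norm (ltW (t_gt0 n))).
  have := kernel_tail k.+1 zD (t_disc n); rewrite zt => tail_le.
  have {}tail_le : `|ev (res n) z - toC (b k) * (z * (toC (t n))^*) ^+ k| <=
      (`|z| * toC (t n)) ^+ k.+1 * toC (4 ^+ k.+1 : R) * K half half.
    rewrite ev_res //; move: tail_le; rewrite big_ord_recr /= opprD addrA; apply.
    apply: (@le_trans _ _ (1 * toC (t n))).
      by apply: ler_wpM2r z_le1; rewrite toC_ge0 ltW.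
    by rewrite mul1r ler_toC.
  have -> : ev (g n) z - z ^+ k =
      (ev (res n) z - toC (b k) * (z * (toC (t n))^*) ^+ k) / toC (b k * t n ^+ k).
    rewrite ev_g // mulrBl; congr (_ - _).
    by rewrite conj_toC exprMn [z ^+ k * _]mulrC mulrA toCM toCX mulrAC mulfV ?mul1r //
      -toCX -toCM.
  have den_gt0 : 0 < b k * t n ^+ k by rewrite mulr_gt0 ?exprn_gt0.
  rewrite normrM normfV normC_toC (gtr0_norm den_gt0).
  rewrite ler_pdivrMr ?toC_gt0 //.
  apply: le_trans tail_le _; rewrite le_eqVlt; apply/orP; left; apply/eqP.
  rewrite /M (toCM (b k)) (toCX (t n)) exprMn [toC (t n) ^+ k.+1]exprS.
  have := B0 k.
  move: (toC (b k)) (`|z| ^+ k.+1) (toC (t n)) (toC (t n) ^+ k) (toC (4 ^+ k.+1 : R)).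
  by move=> y y1 y2 y3 y4 y0; field.
have dot_g_E m l : (l < k)%N -> hdot H (g m) (E l) = 0.
  by move=> lk; rewrite hdotC dot_g dot_E_res // mul0r conjC0.
have dot_g_close m n : `|hdot H (g m) (g n) - toC (b k)^-1| <= toC (t m * t n) * M.
  have den_gt0 : 0 < b k * t n ^+ k by rewrite mulr_gt0 ?exprn_gt0.
  have -> : hdot H (g m) (g n) - toC (b k)^-1 =
      (ev (g m) (toC (t n)) - toC (t n) ^+ k) / toC (b k * t n ^+ k).
    rewrite dot_g dot_res big1 ?subr0; last by move=> l _; rewrite dot_g_E ?mulr0.
    rewrite mulrBl; congr (_ - _).
    have T0 : toC (t n) ^+ k != 0 by rewrite expf_neq0 // fmorph_eq0 gt_eqF.
    by rewrite toCM toCX invfM mulrCA mulfV // mulr1 fmorphV.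
  rewrite normrM normfV normC_toC (gtr0_norm den_gt0).
  rewrite ler_pdivrMr ?toC_gt0 //.
  apply: le_trans (ev_g_close _ _ (t_disc n)) _.
  rewrite normC_toC (gtr0_norm (t_gt0 n)) le_eqVlt; apply/orP; left; apply/eqP.
  by rewrite !toCM toCX exprS; ring.
have g_cauchy m n : `|g m - g n| <= m.+1%:R^-1 + n.+1%:R^-1.
  rewrite -(@ler_pXn2r _ 2) ?nnegrE ?normr_ge0 ?addr_ge0 ?invr_ge0 ?ler0n //.
  have -> : `|g m - g n| ^+ 2 =
      (hdot H (g m) (g m) - toC (b k)^-1) - (hdot H (g m) (g n) - toC (b k)^-1)
      - (hdot H (g n) (g m) - toC (b k)^-1) + (hdot H (g n) (g n) - toC (b k)^-1).
    by rewrite [LHS]hdot_norm hdotBl !hdotBr; ring.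
  rewrite -[leLHS]ger0_norm; last first.
    rewrite (_ : _ + _ = `|g m - g n| ^+ 2) ?exprn_ge0 //.
    by rewrite [RHS]hdot_norm hdotBl !hdotBr; ring.
  apply: (@le_trans _ _ (toC (t m * t m) * M + toC (t m * t n) * M + toC (t n * t m) * M
      + toC (t n * t n) * M)).
    apply: le_trans (ler_normD _ _) _; apply: lerD => //.
    apply: le_trans (ler_normB _ _) _; apply: lerD => //.
    by apply: le_trans (ler_normB _ _) _; apply: lerD.
  have -> : (m.+1%:R^-1 + n.+1%:R^-1) ^+ 2 = toC ((m.+1%:R^-1 + n.+1%:R^-1) ^+ 2) :> C.
    by rewrite toCX rmorphD /= !fmorphV !rmorph_nat.
  rewrite ME -!toCM -!rmorphD ler_toC /t.
  have S2 : rM <= S ^+ 2 by rewrite /S; nra.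
  have -> : (m.+1%:R * S)^-1 * (m.+1%:R * S)^-1 * rM + (m.+1%:R * S)^-1 * (n.+1%:R * S)^-1 * rM
    + (n.+1%:R * S)^-1 * (m.+1%:R * S)^-1 * rM + (n.+1%:R * S)^-1 * (n.+1%:R * S)^-1 * rM
    = (m.+1%:R^-1 + n.+1%:R^-1) ^+ 2 * (rM / S ^+ 2).
    by rewrite !invfM; ring.
  by rewrite ler_piMr ?sqr_ge0 // ler_pdivrMr ?exprn_gt0 // mul1r.
have [e ge] := cauchy_inv_cvg g_cauchy.
have dot_lim f c : (forall n, hdot H (g n) f = c) -> hdot H e f = c.
  move=> gf; apply: cvgC_unique (cvg_hdotl ge) _.
  by rewrite (_ : (fun n => _) = fun=> c); [exact: cvg_cst|exact/funext].
have e_at : monomial_at k e.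
  move=> z zD; rewrite -hdot_kernel_at //; apply: cvgC_unique (cvg_hdotl ge) _.
  apply: cvgC_of_dist => eps eps_gt0.
  have Mb_gt0 : 0 < M * toC (b k) + 1.
    by rewrite ltr_wpDl // mulr_ge0 // toC_ge0 ltW.
  have [N hN] := invS_lt_eps (divr_gt0 eps_gt0 Mb_gt0); exists N => n Nn.
  rewrite distrC hdot_kernel_at //; apply: le_lt_trans (ev_g_close _ _ zD) _.
  have z_le1 : `|z| <= 1 by apply: ltW; move: zD; rewrite inE.
  apply: (@le_lt_trans _ _ (n.+1%:R^-1 * (M * toC (b k) + 1))); last first.
    by rewrite -ltr_pdivlMr //; exact: hN.
  apply: ler_pM.
  - by apply: mulr_ge0; [exact/exprn_ge0/normr_ge0|rewrite toC_ge0 ltW].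
  - by apply: mulr_ge0 => //; rewrite toC_ge0 ltW.
  - apply: (@le_trans _ _ (1 * toC (t n))).
      apply: ler_wpM2r; first by rewrite toC_ge0 ltW.
      by apply: exprn_ile1 => //; exact: normr_ge0.
    rewrite mul1r -(rmorph_nat (@toC R)) -fmorphV ler_toC.
    apply: le_trans (t_inv n) _; rewrite ler_piMr ?invr_ge0 // invf_le1 // ler1n //.
  - by rewrite lerDl.
have e_E l : (l < k)%N -> hdot H e (E l) = 0.
  by move=> lk; apply: dot_lim => n; exact: dot_g_E.
exists e; split.
- exact: e_at.
- apply: dot_lim => n; rewrite hdotC dot_g dot_res big1 ?subr0; last first.
    by move=> l _; rewrite e_E ?mulr0.
  rewrite e_at // -toCX -fmorphV -toCM conj_toC invfM mulrCA mulfV ?mulr1 //.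
  by rewrite expf_neq0 ?gt_eqF.
- move=> l e' lk e'_at; rewrite (_ : e' = E l); first by rewrite hdotC e_E // conjC0.
  by apply: ev_inj => z zD; rewrite e'_at // E_at.
Qed.

Lemma monomial_ex k : exists e, monomial_spec k e.
Proof. by elim/ltn_ind: k => k IH; exact: monomial_step. Qed.

(** Totality: a vector orthogonal to all monomials is orthogonal to the kernel
    functions, which are limits in norm of their partial sums; so its values vanish. *)
Theorem rkhs_monomials : exists e : nat -> H,
  [/\ forall k z, z \in disc R -> ev (e k) z = z ^+ k,
      forall k l, hdot H (e k) (e l) = if k == l then toC (b k)^-1 else 0 &
      total_family e].
Proof.
have [e he] := choice monomial_ex.
have e_at k : monomial_at k (e k) by case: (he k).
have e_orth k l : hdot H (e k) (e l) = if k == l then toC (b k)^-1 else 0.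
  have [kl|lk|kl] := ltngtP k l.
  - by have [_ _ h] := he l; exact: (h k).
  - by have [_ _ h] := he k; rewrite hdotC (h l) ?conjC0.
  - by rewrite -kl; have [_ ->] := he k.
exists e; split => //; apply: (total_orthogonal b_gt0 e_orth) => f f_e.
apply: ev_inj => w wD.
rewrite -[in RHS](scale0r f) -!hdot_kernel_at // hdotZl mul0r.
pose Q n : H := \sum_(l < n) (toC (b l) * w^* ^+ l) *: e l.
have f_Q n : hdot H f (Q n) = 0.
  by rewrite hdot_sumr big1 // => l _; rewrite hdotZr f_e mulr0.
pose Kw := series (fun k => (real_complex R (b k) : C) * (w * w^*) ^+ k).
have dist_Q n : `|kernel_at w - Q n| ^+ 2 = K w w - Kw n.
  have Q_kw : hdot H (Q n) (kernel_at w) = Kw n.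
    rewrite hdot_suml /Kw /series /= big_mkord; apply: eq_bigr => l _.
    by rewrite hdotZl hdot_kernel_at // e_at // exprMn [w ^+ l * _]mulrC mulrA.
  have Q_Q : hdot H (Q n) (Q n) = Kw n.
    rewrite hdot_suml /Kw /series /= big_mkord; apply: eq_bigr => l _.
    rewrite hdotZl hdot_sumr (bigD1 l) //= big1 ?addr0.
      rewrite hdotZr e_orth eqxx rmorphM /= conj_toC rmorphXn /= conjCK exprMn fmorphV.
      rewrite -[real_complex R (b l)]/(toC (b l)); field.
      exact: B0.
    move=> i il; rewrite hdotZr e_orth (_ : (l == i :> nat) = false) ?mulr0 //.
    by rewrite eq_sym; exact: negbTE.
  have Q_real : hdot H (kernel_at w) (Q n) = hdot H (Q n) (kernel_at w).
    rewrite hdotC Q_kw -Q_Q; apply/CrealP; rewrite ger0_real //.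
  rewrite [LHS]hdot_norm hdotBl !hdotBr Q_real Q_kw Q_Q hdot_kernel_at // ev_kernel_at //.
  by rewrite subrr subr0.
have Q_lim eps : 0 < eps -> exists N, forall n, (N <= n)%N -> `|kernel_at w - Q n| < eps.
  move=> eps_gt0; have [N hN] := cvgC_dist (K_exp wD wD) (exprn_gt0 2 eps_gt0).
  exists N => n Nn.
  rewrite -(@ltr_pXn2r _ 2) ?nnegrE ?normr_ge0 ?(ltW eps_gt0) //.
  by rewrite -[ltLHS]ger0_norm ?exprn_ge0 // dist_Q; exact: hN.
rewrite hdotC; apply/eqP; rewrite conjC_eq0; apply/eqP.
apply: cvgC_unique (cvg_hdotl Q_lim) _.
rewrite (_ : (fun n => _) = fun=> 0); first exact: cvg_cst.
by apply/funext => n; rewrite hdotC f_Q conjC0.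
Qed.

End Monomials.

(** * Subnormality of the shift *)

Section Shift.
Variables (R : realType) (c : nat -> R).
Local Notation C := (cplx R).
Hypothesis c_cm : completely_monotone c.

Lemma moment_kernel_herm (x y : nat * nat) :
  moment_kernel c x y = (moment_kernel c y x)^*.
Proof.
rewrite /moment_kernel eq_sym; case: eqP => [->|_]; last by rewrite conjC0.
by rewrite conj_toC.
Qed.

Lemma moment_kernel_succ (x y : nat * nat) :
  moment_kernel c (x.1, x.2.+1) (y.1, y.2.+1) =
  moment_kernel c (x.1.+1, x.2) (y.1.+1, y.2).
Proof. by rewrite /moment_kernel /= !addnS !addSn. Qed.

Lemma moment_kernel_adj (x y : nat * nat) :
  moment_kernel c (x.1.+1, x.2) y = moment_kernel c x (y.1, y.2.+1).
Proof. by rewrite /moment_kernel /= addSn addnS. Qed.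

Lemma moment_kernel0 (k l : nat) :
  moment_kernel c (k, 0%N) (l, 0%N) = if k == l then toC (c k) else 0.
Proof. by rewrite /moment_kernel /= !addn0. Qed.

(** The vectors g x of the larger space play the part of z^x.1 conj(z)^x.2. N
    multiplies by z and S by conj(z). *)
Theorem weighted_shift_subnormal (H : hilbert R) (e : nat -> H) :
  (forall k l, hdot H (e k) (e l) = if k == l then toC (c k) else 0) ->
  total_family e ->
  exists T : {linear H -> H},
    [/\ forall k, T (e k) = e k.+1, nonexpansive T & subnormal T].
Proof.
move=> e_gram e_total.
have [K [g [g_gram g_total]]] :=
  kernel_realization (psd_moment_kernel c_cm) moment_kernel_herm.
have psd_eq0 (X : Type) (G G' : X -> X -> C) :
    (forall x y, G x y = G' x y) -> psd (fun x y => G x y - G' x y).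
  move=> GG' s; rewrite /gram_form big1 // => u _; rewrite big1 // => v _.
  by rewrite GG' subrr mulr0.
have psd_sub (X : Type) (h : X -> nat * nat) (G G' : X -> X -> C) :
    (forall x y, G x y = moment_kernel c (h x) (h y)) ->
    (forall x y, G' x y = moment_kernel c ((h x).1.+1, (h x).2) ((h y).1.+1, (h y).2)) ->
    psd (fun x y => G x y - G' x y).
  move=> hG hG'; have := psd_comp h (psd_moment_kernel_diff c_cm).
  congr psd; apply/funext => x; apply/funext => y; by rewrite hG hG'.
have [T [Te Tc]] : exists T : {linear H -> H},
    (forall k, T (e k) = e k.+1) /\ nonexpansive T.
  apply: (nonexpansive_extension e_total).
  by apply: (psd_sub _ (fun k => (k, 0%N))) => k l; rewrite e_gram moment_kernel0.
have [V [Ve Vc]] : exists V : {linear H -> K},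
    (forall k, V (e k) = g (k, 0%N)) /\ nonexpansive V.
  apply: (nonexpansive_extension e_total).
  by apply: psd_eq0 => k l; rewrite e_gram g_gram moment_kernel0.
have [N [Ng Nc]] : exists N : {linear K -> K},
    (forall x, N (g x) = g (x.1.+1, x.2)) /\ nonexpansive N.
  apply: (nonexpansive_extension g_total).
  by apply: (psd_sub _ id) => x y; rewrite g_gram.
have [S [Sg Sc]] : exists S : {linear K -> K},
    (forall x, S (g x) = g (x.1, x.2.+1)) /\ nonexpansive S.
  apply: (nonexpansive_extension g_total).
  by apply: (psd_sub _ id) => x y; rewrite g_gram // moment_kernel_succ.
have bounded (L : hilbert R) (A : {linear L -> L}) : nonexpansive A -> bounded_operator A.
  by move=> Ac; exists 1 => f; rewrite mul1r; exact: Ac.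
have comp_c (L1 L2 L3 : hilbert R) (A : {linear L2 -> L3}) (B : {linear L1 -> L2}) :
    nonexpansive A -> nonexpansive B -> nonexpansive (A \o B).
  by move=> Ac Bc f; exact: le_trans (Ac _) (Bc f).
have id_c (L : hilbert R) : nonexpansive (idfun : {linear L -> L}) by move=> f.
exists T; split => //; split; first exact: bounded.
exists K, V, N; split.
- apply: (total_hdot2 (A := V) (A' := V) (B := idfun) (B' := idfun) e_total e_total) => // k l.
  by rewrite !Ve g_gram e_gram moment_kernel0.
- split; first exact: bounded.
  exists S.
    apply: (total_hdot2 (A := N) (A' := idfun) (B := idfun) (B' := S) g_total g_total) => // x y.
    by rewrite Ng Sg !g_gram moment_kernel_adj.
  apply: (total_ext (A := N \o S) (B := S \o N) g_total); [exact: comp_c|exact: comp_c|].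
  by move=> x; rewrite /= Sg !Ng Sg.
- apply: (total_ext (A := N \o V) (B := V \o T) e_total); [exact: comp_c|exact: comp_c|].
  by move=> k; rewrite /= Ve Ng Te Ve.
Qed.

End Shift.

Theorem proposition2p14 (R : realType) (p q : R) (a : nat -> R)
    (K1 K2 : cplx R -> cplx R -> cplx R)
    (p_gt0 : 0 < p) (le_pq : p <= q) (le_qp1 : q <= p + 1)
    (K1_kernel : pd_kernel K1) (K2_kernel : pd_kernel K2)
    (K1_series : has_expansion (fun k => a k `^ p) K1)
    (K2_series : has_expansion (fun k => a k `^ q) K2)
    (a_alt : completely_alternating a)
    (H : hilbert R) (ev : H -> cplx R -> cplx R)
    (H_rkhs : is_rkhs (fun z w => K1 z w + K2 z w) ev) :
  exists Mz : {linear H -> H}, is_mult_by_z ev Mz /\ subnormal Mz.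
Proof.
have a_bern := bernstein_of_alternating a_alt.
have [a_gt0 _] := a_bern.
pose b k := a k `^ p + a k `^ q.
have b_gt0 k : 0 < b k by rewrite addr_gt0 ?powR_gt0.
have K_series : has_expansion b (fun z w => K1 z w + K2 z w).
  move=> z w zD wD; have K12 := cvgD (K1_series z w zD wD) (K2_series z w zD wD).
  rewrite (_ : series _ = fun n =>
      series (fun k => (real_complex R (a k `^ p) : cplx R) * (z * w^*) ^+ k) n
    + series (fun k => (real_complex R (a k `^ q) : cplx R) * (z * w^*) ^+ k) n);
    first exact: K12.
  apply/funext => n; rewrite /series /= -big_split; apply: eq_bigr => k _ /=.
  by rewrite -mulrDl -rmorphD.
have [e [e_at e_gram e_total]] := rkhs_monomials b_gt0 K_series H_rkhs.
have c_cm := cm_inv_sum_powR a_bern p_gt0 le_pq le_qp1.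
have [T [Te Tc T_sub]] := weighted_shift_subnormal c_cm e_gram e_total.
exists T; split => // f z zD.
have [_ _ _ /(_ z zD) [kz [_ hkz]]] := H_rkhs.
rewrite -!hkz -[z in RHS]conjCK -hdotZr.
apply: (total_hdot (A := T) (B := idfun) e_total) => // k.
by rewrite /= Te hdotZr !hkz conjCK !e_at // exprS.
Qed.
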